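(* Suppose that $\mu$ is basic and that the cooling map $\tau$ satisfies $\lim_{k\to\infty}(\tau(k)-\tau(k-1))=\infty$. Then, for $\mu^{\mathbb{N}}$-a.e. $\Omega$, $$\lim_{n\to\infty}\frac{X_n}{n}=v_\mu\qquad P_0^{\Omega,\tau}\text{-a.s.}$$
   Context: Notation: $\mathbb{N}=\{1,2,\dots\}$, $\mathbb{N}_0=\mathbb{N}\cup\{0\}$. Basic law. Let $\alpha$ be a probability distribution on $(0,1)$ and $\mu=\alpha^{\mathbb{Z}}$, so that under $\mu$ the environment $\omega=(\omega(x))_{x\in\mathbb{Z}}$ is i.i.d. with marginal $\alpha$. Write $\langle\cdot\rangle$ for expectation with respect to $\alpha$ and $\rho=(1-\omega(0))/\omega(0)$. Such a $\mu$ is called basic if (i) (uniform ellipticity) the support of $\alpha$ is contained in $[\mathfrak{c},1-\mathfrak{c}]$ for some $\mathfrak{c}>0$; and (ii) (nestedness) $\rho_{\min}<1<\rho_{\max}$, where $\rho_{\min},\rho_{\max}$ are the minimum and maximum of $\rho$ over the support of $\alpha$. Speed. If $\langle\log\rho\rangle\le 0$, then $v_\mu=0$ when $\langle\rho\rangle\ge 1$ and $v_\mu=\frac{1-\langle\rho\rangle}{1+\langle\rho\rangle}>0$ when $\langle\rho\rangle<1$. If $\langle\log\rho\rangle>0$, then $v_\mu=-v_{\tilde\mu}$, where $\tilde\mu$ is the law of the reflected environment $\tilde\omega(x)=1-\omega(x)$, $x \in \mathbb{Z}$ (i.e. $\rho$ is replaced by $1/\rho$). (In all cases $v_\mu$ is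 the almost sure limit of $Z_n/n$ for the random walk $Z$ started at $0$ in the static environment $\omega$, which jumps from $x$ to $x+1$ with probability $\omega(x)$ and to $x-1$ with probability $1-\omega(x)$.) Random walk in cooling random environment. A cooling map is a strictly increasing function $\tau:\mathbb{N}_0\to\mathbb{N}_0$ with $\tau(0)=0$. Let $\Omega=(\omega_k)_{k\in\mathbb{N}}$ be i.i.d. environments with law $\mu$, i.e. $\Omega$ has law $\mu^{\mathbb{N}}$. For $n\in\mathbb{N}_0$ let $\ell(n)=\inf\{k:\tau(k)>n\}$. Given $(\Omega,\tau)$, $X=(X_n)_{n\in\mathbb{N}_0}$ is the (time-inhomogeneous) Markov chain on $\mathbb{Z}$ with $$P^{\Omega,\tau}(X_{n+1}=x+1\mid X_n=x)=\omega_{\ell(n)}(x),\qquad P^{\Omega,\tau}(X_{n+1}=x-1\mid X_n=x)=1-\omega_{\ell(n)}(x).$$ $P_0^{\Omega,\tau}$ denotes its (quenched) law when $X_0=0$. *)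

(* Defs.v *)
From HB Require Import structures.
From mathcomp Require Import all_boot all_order all_algebra.
From mathcomp Require Import all_classical all_reals all_analysis.

Set Implicit Arguments.
Unset Strict Implicit.
Unset Printing Implicit Defensive.
Import Order.TTheory GRing.Theory Num.Theory.
Import numFieldNormedType.Exports.

Local Open Scope classical_set_scope.
Local Open Scope ring_scope.

HB.instance Definition _ := isPointed.Build int 0.

HB.instance Definition _ := @isMeasurable.Build default_measure_display
  int discrete_measurable discrete_measurable0
  discrete_measurableC discrete_measurableU.

Definition cylinders (I : choiceType) (d : measure_display)
    (T : measurableType d) : set (set (I -> T)) :=
  [set B | exists (i : I) (A : set T),
     measurable A /\ B = (fun f : I -> T => f i) @^-1` A].

Definition product_space (I : choiceType) (d : measure_display)
    (T : measurableType d) := g_sigma_algebraType (@cylinders I d T).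

(* M is the infinite product m^I.  The sets below form a pi-system generating
   the product sigma-algebra, so this determines M uniquely. *)
Definition is_product_law (R : realType) (I : choiceType)
    (d : measure_display) (T : measurableType d)
    (m : probability T R) (M : probability (product_space I T) R) : Prop :=
  forall (s : seq I) (A : I -> set T), uniq s ->
    (forall i, i \in s -> measurable (A i)) ->
    M [set f | forall i, i \in s -> A i (f i)]
    = (\prod_(i <- s) fine (m (A i)))%:E.

Definition environment (R : realType) := product_space int (measurableTypeR R).

Definition path_space := product_space nat int.

(* The odds (1 - omega(0)) / omega(0), as a function of w = omega(0). *)
Definition rho (R : realType) (w : R) : R := (1 - w) / w.

Definition topological_support (R : realType)
    (alpha : probability (measurableTypeR R) R) : set R :=
  [set x | forall U : set R, open U -> U x -> (0 < alpha U)%E].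

(* [inf] and [sup] are the minimum and the maximum: under the first conjunct
   the support is nonempty and compact, and rho is continuous on it. *)
Definition basic (R : realType)
    (alpha : probability (measurableTypeR R) R) : Prop :=
  (exists c : R, 0 < c /\ topological_support alpha `<=` `[c, 1 - c]) /\
  inf (@rho R @` topological_support alpha) < 1
    < sup (@rho R @` topological_support alpha).

(* The speed to the right, as a function of the mean of rho. *)
Definition right_speed (R : realType) (m : \bar R) : R :=
  if (1 <= m)%E then 0 else (1 - fine m) / (1 + fine m).

(* In the second case, v(mu) = - v(mu~) where mu~ is the reflected law; as
   rho (1 - w) = (rho w)^-1, the mean of rho under mu~ is that of rho^-1
   under mu, and <log rho> <= 0 holds under mu~. *)
Definition speed (R : realType)
    (alpha : probability (measurableTypeR R) R) : R :=
  if ('E_alpha[fun w : R => ln (rho w)%R] <= 0)%E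
  then right_speed ('E_alpha[@rho R])%E
  else - right_speed ('E_alpha[fun w : R => ((rho w)^-1)%R])%E.

Record cooling_map := CoolingMap {
  cooling_fun :> nat -> nat;
  cooling_mono : {homo cooling_fun : m n / (m < n)%N};
  cooling0 : cooling_fun 0 = 0%N
}.

Lemma cooling_exceeds (tau : cooling_map) (n : nat) :
  exists k, (n < tau k)%N.
Proof.
exists n.+1; elim: n => [|n IHn].
  by rewrite -{1}(cooling0 tau); apply: cooling_mono.
by apply: leq_ltn_trans IHn _; apply: cooling_mono.
Qed.

Definition ell (tau : cooling_map) (n : nat) : nat :=
  ex_minn (cooling_exceeds tau n).

(* Conditional probability; only meaningful when 0 < P B. *)
Definition cond_pr (R : realType) (d : measure_display) (T : measurableType d)
    (P : probability T R) (A B : set T) : R :=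
  fine (P (A `&` B)) / fine (P B).

Definition history (n : nat) (x : nat -> int) : set path_space :=
  [set X : nat -> int | forall i, (i <= n)%N -> X i = x i].

(* Q is the law of the Markov chain started at 0 in the environments Omega.
   Environments are numbered from 1 in omega_k and from 0 in Omega, that is,
   Omega k = omega_{k+1}; this is why the environment omega_{ell(n)} in force
   at time n is Omega (ell tau n).-1 (note that ell tau n >= 1).
   Conditioning on the whole history encodes the Markov property together with
   the transition probabilities. *)
Definition is_quenched_law (R : realType) (Omega : nat -> int -> R)
    (tau : cooling_map) (Q : probability path_space R) : Prop :=
  Q [set X : nat -> int | X 0 = 0] = 1%E /\
  forall (n : nat) (x : nat -> int), (0 < Q (history n x))%E ->
    cond_pr Q [set X : nat -> int | X n.+1 = x n + 1] (history n x)
      = Omega (ell tau n).-1 (x n) /\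
    cond_pr Q [set X : nat -> int | X n.+1 = x n - 1] (history n x)
      = 1 - Omega (ell tau n).-1 (x n).

(* Main.v *)
(** Quenched part.  Put S_x = 1 + rho_x + rho_x S_(x-1), cut off after K steps of
    the recursion, and let G be the primitive of S.  Along the static walk Z,
    G(Z_n) - n + sum_(k < n) omega r(Z_k) is a martingale with increments bounded
    by B^K, where r, the defect due to the cut-off, is a product of K + 1
    factors, of mean O(theta^K) with theta = <rho>.  The sum of the S_x over an
    interval of length N has mean N s_K and variance at most N D^K, and s_K
    increases to 1 / v.  With K fixed this gives
    P(Z_n >= (v + eps) n) = O(1 / n) for every theta.  If theta < 1, the expected
    number of visits to y is bounded by a Green function that depends only on the
    environment to the right of y, so that the defect sums to O(n theta^K); with
    K of order log n, P(Z_n <= (v - eps) n) is O(n^-eta) for some eta > 0.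
    Reflection, and the inequality rho >= 1 + log rho, give the remaining cases:
    P(|Z_n - v n| >= eps n) = O(n^-eta) uniformly in the starting point.

    Cooling.  Let W be the total length of the blocks on which the increment is
    off by at least a fraction eps.  Since each block uses a fresh environment,
    the mean of (W - m)_+^2 is at most 2 sum T_j^2 p(T_j) = O(n^(2 - eta)), where
    p(t) = O(t^-eta) bounds the probability that a block of length t is off and
    m = sum T_j p(T_j) = o(n) because T_j tends to infinity.
    Hence P(|X_n - v n| >= 3 eps n) = O(n^-eta), which is summable along n = i^A,
    and the ratio of consecutive terms of this sequence tends to 1. *)

Require Import Defs.
From HB Require Import structures.
From mathcomp Require Import all_boot all_order all_algebra.
From mathcomp Require Import all_classical all_reals all_analysis.
From mathcomp Require Import measurable_realfun.
From mathcomp Require Import ring lra zify.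


Set Implicit Arguments.
Unset Strict Implicit.
Unset Printing Implicit Defensive.
Import Order.TTheory GRing.Theory Num.Theory.
Import numFieldNormedType.Exports.
Local Open Scope classical_set_scope.
Local Open Scope ring_scope.

(** * The walk in a static environment *)

Section Walk.
Context {R : realType}.
Implicit Types (w : nat -> int -> R) (u : int -> R) (x y z : int).
Implicit Types (F : seq bool -> R) (s : seq bool).

Definition step (b : bool) : int := if b then 1 else -1.

Definition pos s : int := \sum_(b <- s) step b.

(** Expectation over the n steps of the walk from x. The functional F reads the list of steps, and w
    is indexed by time, so that static and cooling walks share one definition. *)
Fixpoint qE w n x F : R :=
  if n is n'.+1 then
    w 0%N x * qE (fun i => w i.+1) n' (x + 1) (fun s => F (true :: s)) +
    (1 - w 0%N x) * qE (fun i => w i.+1) n' (x - 1) (fun s => F (false :: s))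
  else F [::].

Lemma pos_nil : pos [::] = 0. Proof. by rewrite /pos big_nil. Qed.

Lemma pos_cons b s : pos (b :: s) = step b + pos s.
Proof. by rewrite /pos big_cons. Qed.

Lemma pos_cat s1 s2 : pos (s1 ++ s2) = pos s1 + pos s2.
Proof. by rewrite /pos big_cat. Qed.

Lemma pos_bound s : `|pos s| <= (size s)%:Z.
Proof.
elim: s => [|b s IH]; first by rewrite pos_nil.
by rewrite pos_cons /=; case: b; rewrite /step; lia.
Qed.

Lemma eq_qE w n x F1 F2 : (forall s, size s = n -> F1 s = F2 s) ->
  qE w n x F1 = qE w n x F2.
Proof.
elim: n w x F1 F2 => [|n IH] w x F1 F2 H /=; first exact: H.
by congr (_ * _ + _ * _); apply: IH => s hs; apply: H; rewrite /= hs.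
Qed.

Lemma eq_qE_env w1 w2 n x F : (forall i z, (i < n)%N -> w1 i z = w2 i z) ->
  qE w1 n x F = qE w2 n x F.
Proof.
elim: n w1 w2 x F => [|n IH] w1 w2 x F H //=.
rewrite H //; congr (_ * _ + _ * _); apply: IH => i z hi; exact: H.
Qed.

Lemma qE_cst w n x (a : R) : qE w n x (fun=> a) = a.
Proof. by elim: n w x => [|n IH] w x //=; rewrite !IH; ring. Qed.

Lemma qED w n x F1 F2 :
  qE w n x (fun s => F1 s + F2 s) = qE w n x F1 + qE w n x F2.
Proof. by elim: n w x F1 F2 => [|n IH] w x F1 F2 //=; rewrite !IH; ring. Qed.

Lemma qEZ w n x (a : R) F : qE w n x (fun s => a * F s) = a * qE w n x F.
Proof. by elim: n w x F => [|n IH] w x F //=; rewrite !IH; ring. Qed.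

Lemma le_qE w n x F1 F2 : (forall i z, 0 <= w i z <= 1) ->
  (forall s, size s = n -> F1 s <= F2 s) -> qE w n x F1 <= qE w n x F2.
Proof.
elim: n w x F1 F2 => [|n IH] w x F1 F2 w01 H /=; first exact: H.
have /andP[w0 w1] := w01 0%N x.
by apply: lerD; apply: ler_wpM2l; rewrite ?subr_ge0 //; apply: IH => // s hs;
  apply: H; rewrite /= hs.
Qed.

(** The Markov property at time m. *)
Lemma qE_cat w m n x F : qE w (m + n) x F =
  qE w m x (fun s => qE (fun i => w (m + i)%N) n (x + pos s)
                       (fun t => F (s ++ t))).
Proof.
elim: m w x F => [|m IH] w x F /=; first by rewrite pos_nil addr0.
rewrite !IH; congr (_ * _ + _ * _); apply: eq_qE => s _;
  by rewrite pos_cons addrA.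
Qed.

(** Mirror image: at y the reflected walk steps right with the probability that the original one
    steps left at -y. *)
Lemma qE_opp u n x F :
  qE (fun=> u) n x F =
  qE (fun=> fun y => 1 - u (- y)) n (- x) (fun s => F (map negb s)).
Proof.
elim: n x F => [|n IH] x F //=.
rewrite opprK subKr addrC !IH !opprD opprK.
by congr (_ * _ + _ * _).
Qed.

(** The generator of the static walk in u, applied to G. *)
Definition drift u (G : int -> R) z : R :=
  u z * G (z + 1) + (1 - u z) * G (z - 1) - G z.

(** An additive functional of the walk: d is summed over the position before each step, so the
    endpoint does not count. *)
Fixpoint comp (d : int -> R) x s : R :=
  if s is b :: s' then d x + comp d (x + step b) s' else 0.

Lemma comp_ge0 d x s : (forall z, 0 <= d z) -> 0 <= comp d x s.
Proof. by move=> d0; elim: s x => //= b s IH x; rewrite addr_ge0. Qed.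

Lemma comp_subr (a : R) d x s :
  comp (fun z => a - d z) x s = a * (size s)%:R - comp d x s.
Proof.
elim: s x => [|b s IH] x /=; first by rewrite mulr0 subr0.
by rewrite IH -natr1; ring.
Qed.

Lemma eq_comp d1 d2 x s : d1 =1 d2 -> comp d1 x s = comp d2 x s.
Proof. by move=> e; elim: s x => //= b s IH x; rewrite e IH. Qed.

(** Dynkin's martingale of G. *)
Definition mart u G x s : R := G (x + pos s) - G x - comp (drift u G) x s.

Lemma mart_cons u G x b s : mart u G x (b :: s) =
  (G (x + step b) - G x - drift u G x) + mart u G (x + step b) s.
Proof. by rewrite /mart /= pos_cons addrA; ring. Qed.

Lemma mart_nil u G x : mart u G x [::] = 0.
Proof. by rewrite /mart pos_nil /= addr0 !subrr. Qed.

Lemma qE_mart u G n x : qE (fun=> u) n x (fun s => mart u G x s) = 0.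
Proof.
elim: n x => [|n IH] x /=; first exact: mart_nil.
have E b : qE (fun=> u) n (x + step b) (fun s => mart u G x (b :: s)) =
    G (x + step b) - G x - drift u G x.
  under eq_qE do rewrite mart_cons.
  by rewrite qED qE_cst IH addr0.
have := E true; have := E false; rewrite /step /= => -> ->.
rewrite /drift; ring.
Qed.

(** Martingale increments are orthogonal, so their conditional variances add up; each is at most the
    mean square of a jump of G. *)
Lemma qE_mart2 u G n x (B : R) : (forall z, 0 <= u z <= 1) ->
  (forall z, `|G (z + 1) - G z| <= B) ->
  qE (fun=> u) n x (fun s => mart u G x s ^+ 2) <= n%:R * B ^+ 2.
Proof.
move=> u01 GB; elim: n x => [|n IH] x /=; first by rewrite mart_nil expr0n mul0r.
have E b : qE (fun=> u) n (x + step b) (fun s => mart u G x (b :: s) ^+ 2) =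
    (G (x + step b) - G x - drift u G x) ^+ 2 +
    qE (fun=> u) n (x + step b) (fun s => mart u G (x + step b) s ^+ 2).
  set D := (G _ - _ - _); under eq_qE => s _.
    have -> : mart u G x (b :: s) ^+ 2 = D ^+ 2 +
      (2 * D * mart u G (x + step b) s + mart u G (x + step b) s ^+ 2).
      rewrite mart_cons -/D; ring.
    over.
  by rewrite qED qE_cst qED qEZ qE_mart mulr0 add0r.
have := E true; have := E false; rewrite /step /= => -> ->.
have /andP[u0 u1] := u01 x.
have h1 := IH (x + 1); have h2 := IH (x - 1).
have g1 := GB x; have := GB (x - 1); rewrite subrK distrC => g2.
have {}g1 : (G (x + 1) - G x) ^+ 2 <= B ^+ 2.
  by rewrite -real_normK ?num_real // lerXn2r // nnegrE ?(le_trans _ g1).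
have {}g2 : (G (x - 1) - G x) ^+ 2 <= B ^+ 2.
  by rewrite -real_normK ?num_real // lerXn2r // nnegrE ?(le_trans _ g2).
rewrite -natr1 [leRHS]mulrDl mul1r.
set q1 := qE _ _ _ _ in h1 *; set q2 := qE _ _ _ _ in h2 *.
set p := u x in u0 u1 *.
set a := G (x + 1) - G x in g1 *; set b := G (x - 1) - G x in g2 *.
have -> : drift u G x = p * a + (1 - p) * b by rewrite /drift /a /b /p; ring.
(* Variance of a two-point law: mean square minus squared mean. *)
have e : p * ((a - (p * a + (1 - p) * b)) ^+ 2 + q1) +
   (1 - p) * ((b - (p * a + (1 - p) * b)) ^+ 2 + q2) =
   p * a ^+ 2 + (1 - p) * b ^+ 2 - (p * a + (1 - p) * b) ^+ 2
   + (p * q1 + (1 - p) * q2) by ring.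
rewrite e.
have k1 := ler_wpM2l u0 g1; have k2 := ler_wpM2l u0 h1.
have p1 : 0 <= 1 - p by rewrite subr_ge0.
have k3 := ler_wpM2l p1 g2; have k4 := ler_wpM2l p1 h2.
have k5 := sqr_ge0 (p * a + (1 - p) * b).
lra.
Qed.

(** Each step inside the window costs V at least h in mean, and V stays nonnegative. The n positions
    that count lie strictly between lo and hi. *)
Lemma qE_lyapunov u (V h : int -> R) (lo hi : int) n x :
  (forall z, 0 <= u z <= 1) -> (forall z, 0 <= V z) ->
  (forall z, lo < z < hi -> drift u V z <= - h z) ->
  lo <= x - n%:Z -> x + n%:Z <= hi ->
  qE (fun=> u) n x (comp h x) <= V x.
Proof.
move=> u01 V0 hd; elim: n x => [|n IH] x xl xh //=.
rewrite !qED !qE_cst.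
have h1 := IH (x + 1) ltac:(lia) ltac:(lia).
have h2 := IH (x - 1) ltac:(lia) ltac:(lia).
have /andP[u0 u1] := u01 x.
have k2 := ler_wpM2l u0 h1.
have p1 : 0 <= 1 - u x by rewrite subr_ge0.
have k4 := ler_wpM2l p1 h2.
have := hd x ltac:(lia); rewrite /drift /step.
lra.
Qed.

(* The mean time to go from y to y + 1, cut off after K steps of its recursion
   towards the left. *)
Fixpoint Sf u K y : R :=
  if K is K'.+1 then 1 + rho (u y) + rho (u y) * Sf u K' (y - 1) else 0.

(** The product rho_y ... rho_(y-j+1) (1 + rho_(y-j)), which is what one more step of the recursion
    adds to [Sf u j y]. *)
Fixpoint rf u j y : R :=
  if j is j'.+1 then rho (u y) * rf u j' (y - 1) else 1 + rho (u y).

Lemma SfS u K y : Sf u K.+1 y = Sf u K y + rf u K y.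
Proof.
elim: K y => [|K IH] y; first by rewrite /=; ring.
rewrite [LHS]/= -/(Sf u K.+1 (y - 1)) IH /=; ring.
Qed.

Lemma Sf_ext u u' K y : (forall z, z <= y -> u z = u' z) ->
  Sf u K y = Sf u' K y.
Proof.
elim: K y => [|K IH] y H //=.
rewrite H // IH // => z hz; apply: H; lia.
Qed.

Lemma rf_ext u u' j y : (forall z, z <= y -> u z = u' z) ->
  rf u j y = rf u' j y.
Proof.
elim: j y => [|j IH] y H //=; rewrite H //.
rewrite IH // => z hz; apply: H; lia.
Qed.

(** * Quenched deviation bounds in an elliptic environment *)

Section Elliptic.
Variables (u : int -> R) (c : R).
Hypothesis c0 : 0 < c.
Hypothesis uc : forall y, c <= u y <= 1 - c.

Lemma elliptic_gt0 y : 0 < u y.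
Proof. by have /andP[h _] := uc y; exact: lt_le_trans h. Qed.

Lemma elliptic01 y : 0 <= u y <= 1.
Proof.
have /andP[h1 h2] := uc y; have c_gt0 := c0.
by apply/andP; split; lra.
Qed.

Lemma rho_ge0 y : 0 <= rho (u y).
Proof.
have /andP[h1 h2] := elliptic01 y.
by rewrite /rho divr_ge0 // subr_ge0.
Qed.

Lemma rho_le y : rho (u y) <= c^-1.
Proof.
have /andP[h1 h2] := uc y; have u0 := elliptic_gt0 y.
rewrite /rho ler_pdivrMr ?elliptic_gt0 //.
have h : 1 <= c^-1 * u y by rewrite mulrC ler_pdivlMr // mul1r.
lra.
Qed.

Lemma mul_rho y : u y * rho (u y) = 1 - u y.
Proof. by rewrite /rho mulrC divfK // lt0r_neq0 // elliptic_gt0. Qed.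

Lemma rf_ge0 j y : 0 <= rf u j y.
Proof.
elim: j y => [|j IH] y /=; first by rewrite addr_ge0 // rho_ge0.
by rewrite mulr_ge0 // rho_ge0.
Qed.

Lemma Sf_ge0 K y : 0 <= Sf u K y.
Proof.
by elim: K y => [|K IH] y //; rewrite SfS addr_ge0 // rf_ge0.
Qed.

Lemma Sf_le K y : Sf u K y <= (1 + 2 * c^-1) ^+ K.
Proof.
have k0 : 0 <= c^-1 by rewrite invr_ge0 ltW.
elim: K y => [|K IH] y /=; first by rewrite expr0.
have r0 := rho_ge0 y; have rk := rho_le y.
have := ler_pM r0 (Sf_ge0 K (y - 1)) rk (IH (y - 1)).
have : 1 <= (1 + 2 * c^-1) ^+ K by rewrite exprn_ege1 // lerDl mulr_ge0.
rewrite exprS; move: (_ ^+ K) => B B1 h.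
(* This product is the slack in 1 + 1/c + B/c <= (1 + 2/c) B. *)
have : 0 <= (1 + c^-1) * (B - 1) by apply: mulr_ge0; lra.
lra.
Qed.

(** The discrete primitive vanishing at 0; the sign on the negative side makes [primS] hold on all
    of Z. *)
Definition prim (h : int -> R) z : R :=
  match z with
  | Posz n => \sum_(i < n) h i%:Z
  | Negz n => - \sum_(i < n.+1) h (Negz i)
  end.

Lemma primS h z : prim h (z + 1) = prim h z + h z.
Proof.
case: z => [n|[|n]].
- by rewrite -PoszD addn1 /= big_ord_recr.
- have -> : Negz 0 + 1 = 0 by [].
  by rewrite /= big_ord0 big_ord_recr big_ord0 /= add0r addNr.
- have -> : Negz n.+1 + 1 = Negz n by rewrite !NegzE; lia.
  by rewrite /= [in RHS]big_ord_recr /=; ring.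
Qed.

Lemma primD h x N : prim h (x + N%:Z) = prim h x + \sum_(i < N) h (x + i%:Z).
Proof.
elim: N => [|N IH]; first by rewrite addr0 big_ord0 addr0.
by rewrite -addn1 PoszD addrA primS IH addn1 big_ord_recr /= addrA.
Qed.

Lemma le_prim h y z : (forall x, 0 <= h x) -> y <= z -> prim h y <= prim h z.
Proof.
move=> h0 yz; have -> : z = y + `|z - y|%N%:Z by lia.
by rewrite primD lerDl sumr_ge0.
Qed.

Local Notation G K := (prim (Sf u K)).

(** A solution of S_z = 1 + rho_z + rho_z S_(z-1) would have a primitive of drift exactly 1, because
    u rho = 1 - u. The cut-off replaces S_z by a value smaller by [rf u K z]. *)
Lemma drift_prim K z : drift u (G K) z = 1 - u z * rf u K z.
Proof.
have e : G K z = G K (z - 1) + Sf u K (z - 1).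
  by rewrite -primS subrK.
rewrite /drift [G K (z + 1)]primS -/(G K z) e.
have r := mul_rho z; have := SfS u K z; rewrite [Sf u K.+1 z]/= => h.
have -> : Sf u K z = 1 + rho (u z) + rho (u z) * Sf u K (z - 1) - rf u K z.
  by rewrite h addrK.
transitivity (u z * (1 + rho (u z) - rf u K z) +
  (u z * rho (u z)) * Sf u K (z - 1) - (1 - u z) * Sf u K (z - 1)); first ring.
by rewrite r mulrBr mulrDr r; ring.
Qed.

Local Notation B K := ((1 + 2 * c^-1) ^+ K).

Lemma mart2_prim K n x :
  qE (fun=> u) n x (fun s => mart u (G K) x s ^+ 2) <= n%:R * B K ^+ 2.
Proof.
apply: qE_mart2; first exact: elliptic01.
move=> z; rewrite primS addrAC subrr add0r ger0_norm ?Sf_ge0 //.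
exact: Sf_le.
Qed.

Lemma mart_prim K x s : mart u (G K) x s =
  G K (x + pos s) - G K x - (size s)%:R + comp (fun z => u z * rf u K z) x s.
Proof.
rewrite /mart (eq_comp _ _ (drift_prim K)) comp_subr mul1r; ring.
Qed.

Lemma comp_rf_ge0 K x s : 0 <= comp (fun z => u z * rf u K z) x s.
Proof.
apply: comp_ge0 => z; rewrite mulr_ge0 ?rf_ge0 //.
by have /andP[] := elliptic01 z.
Qed.

(** If the walk is at distance N or more to the right at time n, monotonicity of G forces D <= - d n
    or a martingale value of at least d n; Chebyshev's inequality covers both. The defect enters
    with the favourable sign, whatever the size of rho. *)
Lemma upper_quenched K n N x (s0 d : R) : (0 < n)%N -> 0 < d ->
  (1 + 2 * d) * n%:R <= N%:R * s0 ->
  qE (fun=> u) n x (fun s => (N%:Z <= pos s)%R%:R) <=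
  ((\sum_(i < N) Sf u K (x + i%:Z) - N%:R * s0) ^+ 2 + n%:R * B K ^+ 2)
  / (d * n%:R) ^+ 2.
Proof.
move=> n0 d0 hN; set D := (\sum_(i < N) _ - _).
have dn : 0 < d * n%:R by rewrite mulr_gt0 // ltr0n.
apply: (@le_trans _ _ (qE (fun=> u) n x (fun s =>
  (d * n%:R) ^- 2 * (D ^+ 2 + mart u (G K) x s ^+ 2)))); last first.
  rewrite qEZ qED qE_cst mulrC ler_wpM2r ?invr_ge0 ?sqr_ge0 //.
  by rewrite lerD2l mart2_prim.
apply: le_qE => [_ z|s hs]; first exact: elliptic01.
rewrite mulrC ler_pdivlMr ?exprn_gt0 //.
case: (boolP (N%:Z <= pos s)) => [hp|_]; last first.
  by rewrite mul0r addr_ge0 // sqr_ge0.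
rewrite mul1r.
have : G K (x + N%:Z) <= G K (x + pos s).
  by apply: le_prim; [exact: Sf_ge0|lia].
have := mart_prim K x s; rewrite hs.
have := comp_rf_ge0 K x s.
rewrite primD -/(G K x).
have -> : \sum_(i < N) Sf u K (x + i%:Z) = D + N%:R * s0 by rewrite subrK.
set C := comp _ _ _; set M := mart _ _ _ _; set g := prim _ (x + pos s).
move=> hC hM hg.
have [hD|hD] := lerP D (- (d * n%:R)).
  by rewrite (le_trans _ (_ : D ^+ 2 <= _)) ?lerDl ?sqr_ge0 //; nra.
rewrite (le_trans _ (_ : M ^+ 2 <= _)) ?lerDr ?sqr_ge0 //.
have : d * n%:R <= M by lra.
by move=> h; nra.
Qed.

(** The inner sum is the largest value of [visit K y L], at y = lo + i, since [rf u (K + m) (y + m)]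
    is rho_(y+m) ... rho_(y+1) times [rf u K y]. *)
Definition green K (lo : int) L : R :=
  \sum_(i < L) \sum_(m < L) rf u (K + m) (lo + i%:Z + m%:Z).

(* As a function of the starting point, the Green function at y of the walk
   killed at y + M, multiplied by u y * rf u K y. *)
Definition visit K y M z : R :=
  \sum_(m < M) rf u (K + m) (y + m%:Z) * (z <= y + m%:Z)%R%:R.

(** To the right of y, the recursion of [rf] and u rho = 1 - u balance the two jumps. To the left of
    y the function is constant, so at y only the jump to the right contributes. *)
Lemma drift_visit K y M z : z < y + M%:Z ->
  drift u (visit K y M) z = - ((z == y)%:R * (u z * rf u K z)).
Proof.
move=> zM.
have e1 : visit K y M (z + 1) - visit K y M z =
    - \sum_(m < M) rf u (K + m) (y + m%:Z) * (z == y + m%:Z)%R%:R.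
  rewrite /visit -sumrB -sumrN; apply: eq_bigr => m _.
  have -> : (z <= y + m%:Z)%R%:R =
      (z + 1 <= y + m%:Z)%R%:R + (z == y + m%:Z)%R%:R :> R.
    rewrite -natrD; congr (_%:R); lia.
  ring.
have e2 : visit K y M (z - 1) - visit K y M z =
    \sum_(m < M) rf u (K + m) (y + m%:Z) * (z - 1 == y + m%:Z)%R%:R.
  rewrite /visit -sumrB; apply: eq_bigr => m _.
  have -> : (z - 1 <= y + m%:Z)%R%:R =
      (z <= y + m%:Z)%R%:R + (z - 1 == y + m%:Z)%R%:R :> R.
    rewrite -natrD; congr (_%:R); lia.
  ring.
have pick (v : int) k : (k < M)%N -> v = y + k%:Z ->
    \sum_(m < M) rf u (K + m) (y + m%:Z) * (v == y + m%:Z)%R%:R = rf u (K + k) v.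
  move=> kM ->; rewrite (bigD1 (Ordinal kM)) //= eqxx mulr1 big1 ?addr0 // => m.
  move=> mk; rewrite [_ == _]negbTE ?mulr0 //.
  by apply: contraNneq mk => h; apply/eqP/val_inj => /=; lia.
have none (v : int) : v < y ->
    \sum_(m < M) rf u (K + m) (y + m%:Z) * (v == y + m%:Z)%R%:R = 0.
  move=> vy; rewrite big1 // => m _; rewrite [_ == _]negbTE ?mulr0 //; lia.
have -> : drift u (visit K y M) z =
    u z * (visit K y M (z + 1) - visit K y M z) +
    (1 - u z) * (visit K y M (z - 1) - visit K y M z) by rewrite /drift; ring.
rewrite e1 e2.
have [zy|yz|zy] := ltgtP z y.
- rewrite !none /=; [ring|lia|lia].
- have [k zk] : exists k, z = y + k.+1%:Z by exists (`|z - y|.-1)%N; lia.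
  have kM : (k.+1 < M)%N by lia.
  rewrite (pick z k.+1) // (pick (z - 1) k) //; [|lia|lia].
  rewrite addnS [rf _ _.+1 _]/= /=; have r := mul_rho z.
  by rewrite -r; ring.
- have M0 : (0 < M)%N by lia.
  rewrite {}zy.
  rewrite (pick y 0%N) ?addr0 // addn0 none; [rewrite /=; ring|lia].
Qed.

(** In n steps the walk stays among the 2 n + 1 sites of [x - n, x + n]. The sum of [visit] over
    these sites is a Lyapunov function for the defect; every killing level y + L lies beyond x + n,
    so killing is never felt. *)
Lemma visit_bound K n x :
  qE (fun=> u) n x (comp (fun z => u z * rf u K z) x) <=
  green K (x - n%:Z) (2 * n).+1.
Proof.
set L := (2 * n).+1; set lo := x - n%:Z.
pose V z := \sum_(i < L) visit K (lo + i%:Z) L z.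
have V_ge0 z : 0 <= V z.
  by do 2!(apply: sumr_ge0 => ? _); rewrite mulr_ge0 ?rf_ge0.
apply: (@le_trans _ _ (V x)).
  apply: (@qE_lyapunov _ _ _ (lo - 1) (lo + L%:Z)) => //.
  - exact: elliptic01.
  - move=> z hz.
    have -> : drift u V z = \sum_(i < L) drift u (visit K (lo + i%:Z) L) z.
      by rewrite /drift /V !mulr_sumr -big_split /= -sumrB.
    have -> : \sum_(i < L) drift u (visit K (lo + i%:Z) L) z =
        - \sum_(i < L) (z == lo + i%:Z)%R%:R * (u z * rf u K z).
      rewrite -sumrN; apply: eq_bigr => i _; rewrite drift_visit //; lia.
    rewrite lerN2.
    have hk : (`|z - lo|%N < L)%N by lia.
    rewrite (bigD1 (Ordinal hk)) //=.
    have -> : z == lo + `|z - lo|%N%:Z by lia.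
    rewrite mul1r lerDl sumr_ge0 // => i _.
    rewrite mulr_ge0 // mulr_ge0 ?rf_ge0 //.
    by have /andP[] := elliptic01 z.
  - lia.
  - lia.
rewrite /V /green; apply: ler_sum => i _; rewrite /visit.
apply: ler_sum => m _.
by case: (x <= _); rewrite ?mulr1 ?mulr0 ?rf_ge0.
Qed.

(** Here the defect has the unfavourable sign, so there is a third alternative: the defect is at
    least d n (Markov's inequality with [visit_bound]), or D is at least d n, or the martingale is
    at most - d n. Hence the margin 3 d. *)
Lemma lower_quenched K n N x (s0 d : R) : (0 < n)%N -> 0 < d ->
  N%:R * s0 <= (1 - 3 * d) * n%:R ->
  qE (fun=> u) n x (fun s => (pos s <= N%:Z)%R%:R) <=
  ((\sum_(i < N) Sf u K (x + i%:Z) - N%:R * s0) ^+ 2 + n%:R * B K ^+ 2)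
  / (d * n%:R) ^+ 2 + green K (x - n%:Z) (2 * n).+1 / (d * n%:R).
Proof.
move=> n0 d0 hN; set D := (\sum_(i < N) _ - _).
have dn : 0 < d * n%:R by rewrite mulr_gt0 // ltr0n.
apply: (@le_trans _ _ (qE (fun=> u) n x (fun s =>
  (d * n%:R) ^- 2 * (D ^+ 2 + mart u (G K) x s ^+ 2) +
  (d * n%:R)^-1 * comp (fun z => u z * rf u K z) x s))); last first.
  rewrite qED !qEZ qED qE_cst lerD //.
    rewrite mulrC ler_wpM2r ?invr_ge0 ?sqr_ge0 //.
    by rewrite lerD2l mart2_prim.
  by rewrite mulrC ler_wpM2r ?invr_ge0 ?(ltW dn) ?visit_bound.
apply: le_qE => [_ z|s hs]; first exact: elliptic01.
have hC := comp_rf_ge0 K x s.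
have A0 : 0 <= (d * n%:R) ^- 2 * (D ^+ 2 + mart u (G K) x s ^+ 2).
  by rewrite mulr_ge0 ?invr_ge0 ?addr_ge0 ?sqr_ge0.
have C0 : 0 <= (d * n%:R)^-1 * comp (fun z => u z * rf u K z) x s.
  by rewrite mulr_ge0 // invr_ge0 ltW.
case: (boolP (pos s <= N%:Z)) => [hp|_]; last by rewrite addr_ge0.
have : G K (x + pos s) <= G K (x + N%:Z).
  by apply: le_prim; [exact: Sf_ge0|lia].
have := mart_prim K x s; rewrite hs.
rewrite primD -/(G K x).
have -> : \sum_(i < N) Sf u K (x + i%:Z) = D + N%:R * s0 by rewrite subrK.
move: A0 C0 hC.
set C := comp _ _ _; set M := mart _ _ _ _; set g := G K (x + pos s).
move=> A0 C0 hC hM hg.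
have [hCd|hCd] := lerP (d * n%:R) C.
  rewrite (le_trans _ (_ : (d * n%:R)^-1 * C <= _)) ?lerDr //.
  by rewrite mulrC ler_pdivlMr // mul1r.
rewrite (le_trans _ (_ : (d * n%:R) ^- 2 * (D ^+ 2 + M ^+ 2) <= _)) ?lerDl //.
rewrite mulrC ler_pdivlMr ?exprn_gt0 // mul1r.
have [hD|hD] := lerP (d * n%:R) D.
  by rewrite (le_trans _ (_ : D ^+ 2 <= _)) ?lerDl ?sqr_ge0 //; nra.
rewrite (le_trans _ (_ : M ^+ 2 <= _)) ?lerDr ?sqr_ge0 //.
have : M <= - (d * n%:R) by lra.
by move=> h; nra.
Qed.

End Elliptic.
End Walk.

(** * Product laws *)

Section BoundedMeasurable.
Context {R : realType} {d : measure_display} {T : measurableType d}.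
Implicit Types f g : T -> R.

(** Ellipticity makes the functionals of the environment bounded, and this class is closed under
    ring operations, so it delivers integrability. *)
Definition bmf f := measurable_fun setT f /\ exists C, forall x, `|f x| <= C.

Lemma bmf_cst (a : R) : bmf (fun=> a).
Proof. by split; [exact: measurable_cst|exists `|a|]. Qed.

Lemma bmfD f g : bmf f -> bmf g -> bmf (fun x => f x + g x).
Proof.
move=> [mf [C hC]] [mg [D hD]]; split; first exact: measurable_funD.
by exists (C + D) => x; rewrite (le_trans (ler_normD _ _)) // lerD.
Qed.

Lemma bmfM f g : bmf f -> bmf g -> bmf (fun x => f x * g x).
Proof.
move=> [mf [C hC]] [mg [D hD]]; split; first exact: measurable_funM.
by exists (C * D) => x; rewrite normrM ler_pM.
Qed.

Lemma bmfN f : bmf f -> bmf (fun x => - f x).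
Proof.
move=> bf; rewrite (_ : (fun x => _) = (fun x => -1 * f x)).
  by apply: bmfM => //; exact: bmf_cst.
by apply/funext => x; rewrite mulN1r.
Qed.

Lemma bmfB f g : bmf f -> bmf g -> bmf (fun x => f x - g x).
Proof. by move=> bf bg; apply: bmfD => //; exact: bmfN. Qed.

Lemma bmfX f n : bmf f -> bmf (fun x => f x ^+ n).
Proof.
move=> bf; elim: n => [|n IH]; first exact: bmf_cst.
rewrite (_ : (fun x => _) = (fun x => f x * f x ^+ n)).
  exact: bmfM.
by apply/funext => x; rewrite exprS.
Qed.

Lemma bmf_sum (J : Type) (r : seq J) (F : J -> T -> R) :
  (forall j, bmf (F j)) -> bmf (fun x => \sum_(j <- r) F j x).
Proof.
move=> bF; elim: r => [|j r IH].
  rewrite (_ : (fun x => _) = (fun=> 0)); first exact: bmf_cst.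
  by apply/funext => x; rewrite big_nil.
rewrite (_ : (fun x => _) = (fun x => F j x + \sum_(j <- r) F j x)).
  exact: bmfD.
by apply/funext => x; rewrite big_cons.
Qed.

Variable P : probability T R.

Definition Ex f : R := \int[P]_x f x.

Lemma bmf_integrable f : bmf f -> P.-integrable setT (EFin \o f).
Proof.
move=> [mf [C hC]]; apply: measurable_bounded_integrable => //.
  exact: (le_lt_trans (probability_le1 P measurableT) (ltry _)).
exists C; split; first exact: num_real.
by move=> D CD x _; apply: le_trans (hC x) (ltW CD).
Qed.

Lemma EFin_Ex f : bmf f -> (Ex f)%:E = (\int[P]_x (f x)%:E)%E.
Proof.
move=> bf; rewrite /Ex /Rintegral fineK //.
exact: integrable_fin_num (bmf_integrable bf).
Qed.

Lemma Ex_cst (a : R) : Ex (fun=> a) = a.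
Proof.
rewrite /Ex Rintegral_cst //.
apply: (etrans (congr1 (fun y => a * fine y) (probability_setT P))).
by rewrite mulr1.
Qed.

Lemma ExD f g : bmf f -> bmf g -> Ex (fun x => f x + g x) = Ex f + Ex g.
Proof. by move=> bf bg; apply: RintegralD => //; exact: bmf_integrable. Qed.

Lemma ExZ (a : R) f : bmf f -> Ex (fun x => a * f x) = a * Ex f.
Proof. by move=> bf; apply: RintegralZl => //; exact: bmf_integrable. Qed.

Lemma Ex_sum (J : Type) (r : seq J) (F : J -> T -> R) :
  (forall j, bmf (F j)) ->
  Ex (fun x => \sum_(j <- r) F j x) = \sum_(j <- r) Ex (F j).
Proof.
move=> bF; elim: r => [|j r IH].
  rewrite big_nil (_ : (fun x => _) = (fun=> 0)) ?Ex_cst //.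
  by apply/funext => x; rewrite big_nil.
rewrite big_cons -IH -ExD //; last exact: bmf_sum.
by congr Ex; apply/funext => x; rewrite big_cons.
Qed.

Lemma le_Ex f g : bmf f -> bmf g -> (forall x, f x <= g x) -> Ex f <= Ex g.
Proof.
by move=> bf bg fg; apply: le_Rintegral => //; exact: bmf_integrable.
Qed.

Lemma Ex_ge0 f : (forall x, 0 <= f x) -> 0 <= Ex f.
Proof. by move=> f0; apply: Rintegral_ge0. Qed.

End BoundedMeasurable.

Lemma bmf_comp (R : realType) d d' (X : measurableType d)
    (Y : measurableType d') (g : X -> Y) (f : Y -> R) :
  measurable_fun setT g -> bmf f -> bmf (fun x => f (g x)).
Proof.
move=> mg [mf [C hC]]; split; first exact: (measurableT_comp mf mg).
by exists C => x; exact: hC.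
Qed.

(** * Boxes, uniqueness of product laws, independence of one coordinate *)

Section ProductLaw.
Context {R : realType} {I : choiceType} {d : measure_display}
  {T : measurableType d}.
Local Notation PS := (product_space I T).
Implicit Types (s : seq I) (A : I -> set T).

Definition box s A : set PS := [set f | forall i, i \in s -> A i (f i)].

Lemma measurable_coord (i : I) : measurable_fun setT (fun f : PS => f i).
Proof.
move=> _ A mA; rewrite setTI; apply: sub_sigma_algebra.
by exists i, A.
Qed.

Lemma measurable_to_product d' (X : measurableType d') (g : X -> PS) :
  (forall i, measurable_fun setT (fun x => g x i)) -> measurable_fun setT g.
Proof.
move=> mg; refine (@measurability _ _ _ PS setT g (@cylinders I d T) erefl _).
move=> _ [_ [i [A [mA ->]]] <-].
exact: mg.
Qed.

Lemma box_nil A : box [::] A = setT.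
Proof. by rewrite /box; apply/seteqP; split. Qed.

Lemma box_cons i s A :
  box (i :: s) A = (fun f : PS => f i) @^-1` A i `&` box s A.
Proof.
apply/seteqP; split => [f H|f [H1 H2]] /=.
  by split=> [|j js]; apply: H; rewrite inE ?eqxx ?js ?orbT.
by move=> j; rewrite inE => /orP[/eqP ->|/H2].
Qed.

Lemma measurable_box s A : (forall i, i \in s -> measurable (A i)) ->
  measurable (box s A).
Proof.
elim: s => [|i s IH] mA; first by rewrite box_nil; exact: measurableT.
rewrite box_cons; apply: measurableI.
  rewrite -[X in measurable X]setTI; apply: measurable_coord => //.
  by apply: mA; rewrite inE eqxx.
by apply: IH => j js; apply: mA; rewrite inE js orbT.
Qed.

(** The boxes form a pi-system generating the product sigma-algebra. *)
Lemma product_measure_ext (M1 M2 : {measure set PS -> \bar R}) :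
  (M1 setT < +oo)%E ->
  (forall s A, uniq s -> (forall i, measurable (A i)) ->
    M1 (box s A) = M2 (box s A)) ->
  forall B, measurable B -> M1 B = M2 B.
Proof.
move=> M1fin H B mB.
pose G : set (set PS) :=
  [set B | exists s A, (forall i, measurable (A i)) /\ B = box s A].
have GT : G setT by exists [::], (fun=> setT); rewrite box_nil.
apply: (@measure_unique _ R PS G (fun=> setT)) => //.
- apply/seteqP; split; apply: smallest_sub => //.
  + move=> _ [i [A [mA ->]]]; apply: sub_sigma_algebra.
    exists [:: i], (fun=> A); split => //.
    by rewrite box_cons box_nil setIT.
  + exact: (@sigma_algebra_measurable _ PS).
  + by move=> _ [s [A [mA ->]]]; apply: measurable_box.
- move=> _ _ [s1 [A1 [mA1 ->]]] [s2 [A2 [mA2 ->]]].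
  (* The intersection of two boxes constrains the coordinates of both lists; the full set stands for
     a missing constraint. *)
  exists (s1 ++ s2), (fun i => (if i \in s1 then A1 i else setT) `&`
                               (if i \in s2 then A2 i else setT)).
  split.
    by move=> i; apply: measurableI; case: ifP.
  apply/seteqP; split => [f [H1 H2] i _|f K] /=.
    by split; case: ifP => // ij; (exact: H1 || exact: H2).
  split => i ij; have := K i; rewrite mem_cat ij ?orbT => /(_ isT)[].
    by [].
  by [].
- by rewrite bigcup_const.
- move=> _ [s [A [mA ->]]].
  have -> : box s A = box (undup s) A.
    by apply/seteqP; split => f K i; have := K i; rewrite mem_undup.
  by apply: H => //; exact: undup_uniq.
Qed.

Definition upd (f : I -> T) i t : I -> T := fun j => if j == i then t else f j.

Variables (m : probability T R) (M : probability PS R).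
Hypothesis HM : is_product_law m M.

Lemma measurable_upd i :
  measurable_fun setT (fun p : PS * T => upd p.1 i p.2 : PS).
Proof.
apply: measurable_to_product => j; rewrite /upd.
case: (j == i); first exact: measurable_snd.
exact: (measurableT_comp (measurable_coord j) measurable_fst).
Qed.

(* Redrawing coordinate i preserves the probability of every box. *)
Lemma resample (i : I) (G : PS -> \bar R) : measurable_fun (setT : set PS) G ->
  (forall f, (0 <= G f)%E) ->
  (\int[M]_f G f = \int[M]_f \int[m]_t G (upd f i t))%E.
Proof.
move=> mG G0.
pose phi := (fun p : PS * T => upd p.1 i p.2 : PS).
have mphi : measurable_fun setT phi := measurable_upd i.
pose P := (M \x m)%E.
pose P'_ : {measure set PS -> \bar R} := pushforward P phi.
pose P' := P'_ mphi.
have E B : measurable B -> M B = P' B.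
  apply: product_measure_ext; first by rewrite -ge0_fin_numE // fin_num_measure.
  move=> s A us mA; rewrite /P' /P'_ /= /pushforward.
  have -> : phi @^-1` box s A =
      box (rem i s) A `*` (if i \in s then A i else setT).
    apply/seteqP; split => [[f t] K|[f t] [/= K1 K2]] /=.
      split=> [j|].
        rewrite mem_rem_uniq // inE => /andP[ji js].
        by have := K j js; rewrite /phi /upd /= (negbTE ji).
      by case: ifP => // is1; have := K i is1; rewrite /phi /upd /= eqxx.
    move=> j js; rewrite /phi /upd /=; case: eqVneq => [ji|ji].
      by move: K2; rewrite -ji js.
    by apply: K1; rewrite mem_rem_uniq // inE ji.
  rewrite product_measure1E; last 2 first.
  - by apply: measurable_box.
  - by case: ifP.
  have mbox r : uniq r -> M (box r A) = (\prod_(j <- r) fine (m (A j)))%:E.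
    by move=> ur; exact: HM.
  apply: (etrans (mbox s us)); apply/esym.
  apply: (etrans (congr1 (fun z => z * _)%E (mbox _ (rem_uniq i us)))).
  case: ifP => is1.
    have -> : \prod_(j <- s) fine (m (A j)) =
        \prod_(j <- rem i s) fine (m (A j)) * fine (m (A i)).
      by rewrite (perm_big _ (perm_to_rem is1)) big_cons mulrC.
    by rewrite EFinM fineK // fin_num_measure.
  apply: (etrans (congr1 (mule _) (probability_setT m))).
  by rewrite mule1 rem_id // is1.
transitivity (\int[P']_f G f)%E.
  by apply: eq_measure_integral => B mB _; exact: E.
rewrite ge0_integral_pushforward // preimage_setT.
rewrite /P fubini_tonelli1 //.
  exact: measurableT_comp.
by move=> p; exact: G0.
Qed.

Lemma Ex_resample (i : I) (G H : PS -> R) : bmf G -> bmf H ->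
  (forall f, Ex m (fun t => G (upd f i t)) = H f) -> Ex M G = Ex M H.
Proof.
move=> bG bH GH; have [mG [C hC]] := bG.
(* Adding the bound C of |G| makes the integrand nonnegative, as [resample] requires. *)
suff : Ex M (fun f => G f + C) = Ex M (fun f => H f + C).
  by rewrite !ExD ?Ex_cst //; [move/addIr|exact: bmf_cst|exact: bmf_cst].
have bGC : bmf (fun f => G f + C) by apply: bmfD => //; exact: bmf_cst.
have bHC : bmf (fun f => H f + C) by apply: bmfD => //; exact: bmf_cst.
apply: EFin_inj; rewrite !EFin_Ex // (resample i).
- apply: eq_integral => f _; rewrite -EFin_Ex.
    rewrite ExD ?GH ?Ex_cst //; last exact: bmf_cst.
    apply: (bmf_comp _ bG); apply: measurable_to_product => j.
    by rewrite /upd; case: (j == i); [exact: measurable_id|exact: measurable_cst].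
  apply: (bmf_comp _ bGC); apply: measurable_to_product => j.
  by rewrite /upd; case: (j == i); [exact: measurable_id|exact: measurable_cst].
- by apply/measurable_EFinP; case: bGC.
- move=> f; rewrite lee_fin -lerBlDr sub0r.
  by have := hC f; rewrite ler_norml => /andP[].
Qed.

(** Redrawing coordinate i leaves F alone and averages f. *)
Lemma Ex_indep (i : I) (f : T -> R) (F : PS -> R) : bmf f -> bmf F ->
  (forall g t, F (upd g i t) = F g) ->
  Ex M (fun g => f (g i) * F g) = Ex m f * Ex M F.
Proof.
move=> bf bF Fi; rewrite -ExZ //.
apply: (Ex_resample (i := i)).
- by apply: bmfM => //; apply: bmf_comp bf; exact: measurable_coord.
- by apply: bmfM => //; exact: bmf_cst.
move=> g; transitivity (Ex m (fun t => F g * f t)).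
  by congr Ex; apply/funext => t; rewrite Fi /upd eqxx mulrC.
by rewrite ExZ // mulrC.
Qed.

End ProductLaw.

(** * Moments of the truncated hitting times *)

Section Static.
Context {R : realType}.
Variables (alpha : probability (measurableTypeR R) R)
  (mu : probability (environment R) R).
Hypothesis Hmu : is_product_law alpha mu.
Variables (phi : R -> R) (c : R) (sigma : int -> int).
Hypothesis mphi : measurable_fun [set: measurableTypeR R] phi.
Hypothesis c0 : 0 < c.
Hypothesis phic : forall w, c <= phi w <= 1 - c.
Hypothesis sigma_inj : injective sigma.

(** The pair (phi, sigma) lets one argument serve the environment, with sigma the identity, and its
    reflection, where phi is 1 minus the clipped value and sigma the negation. *)
Definition env (omega : int -> R) : int -> R := fun y => phi (omega (sigma y)).

Definition mean_rho : R := Ex alpha (fun w => rho (phi w)).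

Local Notation theta := mean_rho.
Implicit Types (x y z : int) (K N n : nat).

Lemma env_upd omega y t z :
  env (upd omega (sigma y) t) z = if z == y then phi t else env omega z.
Proof. by rewrite /env /upd (inj_eq sigma_inj); case: ifP. Qed.

Lemma env_elliptic omega y : c <= env omega y <= 1 - c.
Proof. exact: phic. Qed.

Lemma phi_gt0 w : 0 < phi w.
Proof. by have /andP[h _] := phic w; exact: lt_le_trans h. Qed.

Lemma bmf_phi : bmf (phi : measurableTypeR R -> R).
Proof.
split=> //; exists 1 => w; have /andP[h1 h2] := phic w; have c_gt0 := c0.
by rewrite ger0_norm; lra.
Qed.

Lemma bmf_rho : bmf (fun w : measurableTypeR R => rho (phi w)).
Proof.
split; last first.
  exists c^-1 => w; rewrite ger0_norm.
    exact: (rho_le c0 (u := fun=> phi w) (fun=> phic w) 0).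
  exact: (rho_ge0 c0 (u := fun=> phi w) (fun=> phic w) 0).
rewrite (_ : (fun _ => _) = (fun w => (1 - phi w) * (phi w) `^ (-1))).
  apply: measurable_funM; first exact: measurable_funB.
  exact: (measurableT_comp (measurable_powR (-1)) mphi).
by apply/funext => w; rewrite powR_inv1 // ltW // phi_gt0.
Qed.

Lemma bmf_coord y (f : measurableTypeR R -> R) : bmf f ->
  bmf (fun omega : environment R => f (omega y)).
Proof. by move=> bf; apply: bmf_comp bf; exact: measurable_coord. Qed.

Lemma bmf_Sf K y : bmf (fun omega : environment R => Sf (env omega) K y).
Proof.
elim: K y => [|K IH] y /=; first exact: bmf_cst.
apply: bmfD; first by apply: bmfD; [exact: bmf_cst|exact: bmf_coord bmf_rho].
by apply: bmfM => //; exact: bmf_coord bmf_rho.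
Qed.

Lemma bmf_rf j y : bmf (fun omega : environment R => rf (env omega) j y).
Proof.
elim: j y => [|j IH] y /=.
  by apply: bmfD; [exact: bmf_cst|exact: bmf_coord bmf_rho].
by apply: bmfM => //; exact: bmf_coord bmf_rho.
Qed.

Lemma bmf_qE n x F :
  bmf (fun omega : environment R => qE (fun=> env omega) n x F).
Proof.
elim: n x F => [|n IH] x F /=; first exact: bmf_cst.
have b : bmf (fun omega : environment R => env omega x).
  exact: bmf_coord bmf_phi.
apply: bmfD; first by apply: bmfM.
by apply: bmfM => //; apply: bmfB => //; exact: bmf_cst.
Qed.

Lemma theta_ge0 : 0 <= theta.
Proof.
apply: Ex_ge0 => w; exact: (rho_ge0 c0 (u := fun=> phi w) (fun=> phic w) 0).
Qed.

Lemma theta_le : theta <= c^-1.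
Proof.
rewrite -[leRHS](Ex_cst alpha); apply: le_Ex; [exact: bmf_rho|exact: bmf_cst|].
move=> w; exact: (rho_le c0 (u := fun=> phi w) (fun=> phic w) 0).
Qed.

Lemma Ex_rf j y : Ex mu (fun omega : environment R => rf (env omega) j y) =
  (1 + theta) * theta ^+ j.
Proof.
elim: j y => [|j IH] y.
  rewrite expr0 mulr1 /= ExD; [|exact: bmf_cst|exact: bmf_coord bmf_rho].
  rewrite Ex_cst; congr (_ + _).
  have := Ex_indep Hmu (i := sigma y) bmf_rho (bmf_cst (1 : R)) (fun _ _ => erefl).
  rewrite Ex_cst mulr1 /mean_rho => <-; congr Ex; apply/funext => omega.
  by rewrite mulr1.
rewrite /= (Ex_indep Hmu (i := sigma y) bmf_rho (bmf_rf j (y - 1))) ?IH -/mean_rho.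
  by rewrite exprS; ring.
move=> g t; apply: rf_ext => z zy; rewrite env_upd ifF //; lia.
Qed.

(** The recursion of [Sf] with means taken: rho at y is independent of the sites to the left of
    y. *)
Fixpoint mean_S K : R := if K is K'.+1 then 1 + theta + theta * mean_S K' else 0.

Local Notation B K := ((1 + 2 * c^-1) ^+ K).
Local Notation D := (10 * (1 + 2 * c^-1) ^+ 2).

Lemma B_ge1 K : 1 <= B K.
Proof. by rewrite exprn_ege1 // lerDl mulr_ge0 // invr_ge0 ltW. Qed.

(** A martingale in N: each summand is a centred function of one site times a function of the sites
    further left. *)
Definition innov K N x (omega : environment R) : R := \sum_(i < N)
  (rho (env omega (x + i%:Z)) - theta) * (1 + Sf (env omega) K (x + i%:Z - 1)).

(** The summands are orthogonal, since redrawing the rightmost site affects only its centred factor.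
    That factor is at most 1/c in absolute value, as rho and theta both lie in [0, 1/c]. *)
Lemma Ex_innov2 K N x :
  bmf (innov K N x) /\
  Ex mu (fun omega : environment R => innov K N x omega ^+ 2) <=
  N%:R * (c^-1 ^+ 2 * (1 + B K) ^+ 2).
Proof.
have b y : bmf (fun omega : environment R => 1 + Sf (env omega) K y).
  by apply: bmfD; [exact: bmf_cst|exact: bmf_Sf].
have bt : bmf (fun w : measurableTypeR R => rho (phi w) - theta).
  by apply: bmfB; [exact: bmf_rho|exact: bmf_cst].
have binnov n : bmf (innov K n x).
  rewrite /innov; apply: bmf_sum => i; apply: bmfM => //; exact: bmf_coord bt.
split=> //.
have innov_upd n t (g : environment R) :
    innov K n x (upd g (sigma (x + n%:Z)) t) = innov K n x g.
  rewrite /innov; apply: eq_bigr => i _; have ilt := ltn_ord i.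
  rewrite env_upd ifF; last lia.
  congr (_ * (_ + _)); apply: Sf_ext => z zy; rewrite env_upd ifF //; lia.
elim: N => [|n IH].
  rewrite mul0r le_eqVlt; apply/orP; left; apply/eqP.
  rewrite -[RHS](Ex_cst mu); congr Ex; apply/funext => omega.
  by rewrite /innov big_ord0 expr0n.
pose y := x + n%:Z.
pose A (omega : environment R) := 1 + Sf (env omega) K (y - 1).
have A_upd (g : environment R) t : A (upd g (sigma y) t) = A g.
  rewrite /A; congr (_ + _); apply: Sf_ext => z zy; rewrite env_upd ifF //; lia.
have bA : bmf A := b _.
have bF : bmf (fun omega : environment R => 2 * (A omega * innov K n x omega)).
  by apply: bmfM; [exact: bmf_cst|apply: bmfM].
have cross : Ex mu (fun omega : environment R => (rho (env omega y) - theta) *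
    (2 * (A omega * innov K n x omega))) = 0.
  have := Ex_indep Hmu (i := sigma y) bt bF.
  rewrite (_ : Ex alpha _ = 0) ?mul0r; last first.
    rewrite ExD; [|exact: bmf_rho|exact: bmf_cst].
    by rewrite Ex_cst subrr.
  by apply=> g t; rewrite A_upd innov_upd.
have -> : (fun omega : environment R => innov K n.+1 x omega ^+ 2) = (fun omega : environment R =>
    innov K n x omega ^+ 2 + ((rho (env omega y) - theta) *
    (2 * (A omega * innov K n x omega)) +
    ((rho (env omega y) - theta) * A omega) ^+ 2)).
  by apply/funext => omega; rewrite /innov big_ord_recr /= -/y /A; ring.
have brA : bmf (fun omega : environment R => (rho (env omega y) - theta) * A omega).
  by apply: bmfM => //; exact: bmf_coord bt.
rewrite ExD; [|exact: bmfX|]; last first.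
  by apply: bmfD; [apply: bmfM => //; exact: bmf_coord bt|exact: bmfX].
rewrite ExD; [|by apply: bmfM => //; exact: bmf_coord bt|exact: bmfX].
rewrite cross add0r -natr1 [leRHS]mulrDl lerD // mul1r.
rewrite -[leRHS](Ex_cst mu); apply: le_Ex; [exact: bmfX|exact: bmf_cst|].
move=> omega; rewrite exprMn ler_pM ?sqr_ge0 //.
  have r0 := rho_ge0 c0 (env_elliptic omega) y.
  have r1 := rho_le c0 (env_elliptic omega) y.
  have t0 := theta_ge0; have t1 := theta_le.
  rewrite -real_normK ?num_real // lerXn2r // ?nnegrE //.
    by rewrite (le_trans r0).
  by rewrite ler_norml; lra.
have S0 := Sf_ge0 c0 (env_elliptic omega) K (y - 1).
have S1 := Sf_le c0 (env_elliptic omega) K (y - 1).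
by rewrite lerXn2r // ?nnegrE ?addr_ge0 ?lerD2l // (le_trans S0).
Qed.

Definition dev K N x (omega : environment R) : R :=
  \sum_(i < N) Sf (env omega) K (x + i%:Z) - N%:R * mean_S K.

Lemma bmf_dev K N x : bmf (dev K N x).
Proof.
apply: bmfB; last exact: bmf_cst.
by apply: bmf_sum => i; exact: bmf_Sf.
Qed.

(** Induction on K: the deviation at K + 1 is [innov] plus theta times the deviation at K, one site
    to the left. The innovation has variance of order N, which keeps the bound linear in N. *)
Lemma Ex_dev2 K N x :
  Ex mu (fun omega : environment R => dev K N x omega ^+ 2) <= N%:R * D ^+ K.
Proof.
elim: K x => [|K IH] x.
  rewrite (_ : (fun _ => _) = (fun=> 0)) ?Ex_cst ?mulr1 //.
  by apply/funext => omega; rewrite /dev /= big1 // mulr0 subrr expr0n.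
(* From S_(K+1)(y) = (rho_y - theta)(1 + S_K(y - 1)) + 1 + theta + theta S_K(y - 1). *)
have e omega : dev K.+1 N x omega =
    innov K N x omega + theta * dev K N (x - 1) omega.
  rewrite /dev /innov mulrBr mulr_sumr addrA -big_split /=.
  rewrite (_ : N%:R * (1 + theta + _) = \sum_(i < N) (1 + theta) +
      theta * (N%:R * mean_S K)); last first.
    by rewrite sumr_const card_ord -mulr_natl; ring.
  rewrite opprD addrA -sumrB; congr (_ - _); apply: eq_bigr => i _.
  rewrite (_ : x - 1 + i%:Z = x + i%:Z - 1); [ring|lia].
have [bi hi] := Ex_innov2 K N x.
have bd := bmf_dev K N (x - 1).
apply: (@le_trans _ _ (2 * Ex mu (fun omega : environment R => innov K N x omega ^+ 2) +
  2 * theta ^+ 2 * Ex mu (fun omega : environment R => dev K N (x - 1) omega ^+ 2))).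
  have b1 : bmf (fun omega : environment R => 2 * innov K N x omega ^+ 2).
    by apply: bmfM; [exact: bmf_cst|exact: bmfX].
  have b2 : bmf (fun omega : environment R =>
      2 * theta ^+ 2 * dev K N (x - 1) omega ^+ 2).
    by apply: bmfM; [exact: bmf_cst|exact: bmfX].
  have <- : Ex mu (fun omega : environment R => 2 * innov K N x omega ^+ 2) =
      2 * Ex mu (fun omega : environment R => innov K N x omega ^+ 2).
    by rewrite ExZ //; exact: bmfX.
  have <- : Ex mu (fun omega : environment R =>
      2 * theta ^+ 2 * dev K N (x - 1) omega ^+ 2) =
      2 * theta ^+ 2 * Ex mu (fun omega : environment R =>
        dev K N (x - 1) omega ^+ 2).
    by rewrite ExZ //; exact: bmfX.
  rewrite -ExD //.
  apply: le_Ex; first by apply: bmfX; exact: bmf_dev.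
    exact: bmfD.
  move=> omega; rewrite e.
  have := sqr_ge0 (innov K N x omega - theta * dev K N (x - 1) omega).
  move: (innov _ _ _ _) (dev _ _ _ _) => a b h.
  rewrite -subr_ge0; rewrite (_ : _ - _ = (a - theta * b) ^+ 2) //; ring.
have k0 : 0 <= c^-1 by rewrite invr_ge0 ltW.
have hd := IH (x - 1).
have t0 := theta_ge0; have t1 := theta_le.
have t2 : theta ^+ 2 <= c^-1 ^+ 2 by rewrite lerXn2r ?nnegrE.
have B1 := B_ge1 K.
have D0 : 0 <= D ^+ K by rewrite exprn_ge0 // mulr_ge0 ?sqr_ge0.
have BD : (1 + B K) ^+ 2 <= 4 * D ^+ K.
  apply: (@le_trans _ _ (4 * B K ^+ 2)); first nra.
  rewrite ler_wpM2l // -exprM mulnC exprM lerXn2r ?nnegrE ?sqr_ge0 //.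
    by rewrite mulr_ge0 ?sqr_ge0.
  by rewrite ler_peMl ?sqr_ge0 // ler1n.
have N0 : 0 <= N%:R :> R by [].
have kk : 10 * c^-1 ^+ 2 <= D.
  by rewrite ler_wpM2l // lerXn2r ?nnegrE ?addr_ge0 ?mulr_ge0 //; lra.
rewrite [D ^+ K.+1]exprS.
(* The coefficients 8 and 2 of the two terms add up to the factor 10 in D. *)
apply: (@le_trans _ _ (2 * (N%:R * (c^-1 ^+ 2 * (4 * D ^+ K))) +
   2 * c^-1 ^+ 2 * (N%:R * D ^+ K))).
  apply: lerD.
    rewrite ler_wpM2l // (le_trans hi) // ler_wpM2l // ler_wpM2l ?sqr_ge0 //.
  by rewrite ler_pM ?mulr_ge0 ?sqr_ge0 // ?Ex_ge0 // ?ler_wpM2l // => ?;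
     rewrite sqr_ge0.
rewrite (_ : _ + _ = N%:R * ((10 * c^-1 ^+ 2) * D ^+ K)); last by ring.
by rewrite ler_wpM2l // ler_wpM2r //.
Qed.

End Static.

(** * Polynomial deviation bounds *)

Section PolynomialRate.
Context {R : realType}.

Lemma expr_small (q eps : R) : 0 <= q < 1 -> 0 < eps -> exists K, q ^+ K < eps.
Proof.
move=> /andP[q0 q1] e0.
have /cvgrPdist_lt /(_ _ e0) [K _ /(_ K)] :
  (fun k => q ^+ k) @ \oo --> (0 : R) by apply: cvg_expr; rewrite ger0_norm.
rewrite sub0r normrN ger0_norm ?exprn_ge0 // => h; exists K; exact: h (leqnn K).
Qed.

Lemma nat_upper (a : R) : exists N : nat, a <= N%:R.
Proof.
exists (Num.bound `|a|); apply: ltW; apply: le_lt_trans (ler_norm a) _.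
exact: archi_boundP.
Qed.

(** The bound is uniform in x. Requiring eta <= 1 makes t^(1 - eta) nondecreasing, as used in
    [var_bad_le]. *)
Definition polydecay (X : Type) (p : nat -> X -> R) : Prop :=
  exists2 C : R, 0 <= C & exists2 eta : R, 0 < eta <= 1 &
    forall n x, (0 < n)%N -> p n x <= C * n%:R `^ (- eta).

Variable X : Type.
Implicit Types p q : nat -> X -> R.

Lemma polydecay_inv p (C : R) : 0 <= C ->
  (forall n x, (0 < n)%N -> p n x <= C / n%:R) -> polydecay p.
Proof.
move=> C0 H; exists C => //; exists 1; first by rewrite ltr01 lexx.
by move=> n x n0; rewrite powR_inv1 ?H.
Qed.

(* With b >= D / q, the choice K = log_b n makes D ^ K / n at most q ^ K. *)
Lemma polydecay_opt p (C D q : R) :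
  0 <= C -> 1 <= D -> 0 < q < 1 ->
  (forall K n x, (0 < n)%N -> p n x <= C * (D ^+ K / n%:R + q ^+ K)) ->
  polydecay p.
Proof.
move=> C0 D1 /andP[q0 q1] H.
have [b0 hb0] := nat_upper (D / q).
pose b := maxn b0 2.
have b2 : (1 < b)%N by rewrite leq_max orbT.
have b_gt0 : 0 < b%:R :> R by rewrite ltr0n; lia.
have hb : D <= b%:R * q.
  rewrite -ler_pdivrMr // (le_trans hb0) // ler_nat leq_maxl //.
have lnb : 0 < ln (b%:R : R) by rewrite ln_gt0 // ltr1n.
have lnq : ln q < 0 by rewrite ln_lt0 // q0 q1.
pose eta := - ln q / ln (b%:R : R).
have eta0 : 0 < eta by rewrite divr_gt0 // oppr_gt0.
have powb : (b%:R : R) `^ (- eta) = q.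
  rewrite /powR gt_eqF // (_ : - eta * _ = ln q) ?lnK //.
  by rewrite /eta; field; rewrite gt_eqF.
have eta1 : eta <= 1.
  rewrite /eta ler_pdivrMr // mul1r -subr_ge0 opprK addrC -lnM ?posrE //.
  by rewrite ln_ge0 // mulrC (le_trans D1).
exists (2 * C / q); first by rewrite divr_ge0 ?mulr_ge0 // ltW.
exists eta; first by rewrite eta0 eta1.
move=> n x n0; have n_gt0 : 0 < n%:R :> R by rewrite ltr0n.
have /andP[k1 k2] := trunc_log_bounds b2 n0.
set K := trunc_log b n in k1 k2.
apply: (le_trans (H K n x n0)).
have DK : D ^+ K / n%:R <= q ^+ K.
  rewrite ler_pdivrMr //; apply: (@le_trans _ _ ((b%:R * q) ^+ K)).
    by rewrite lerXn2r // ?nnegrE; lra.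
  rewrite exprMn mulrC ler_wpM2l ?exprn_ge0 ?(ltW q0) //.
  by rewrite -natrX ler_nat.
(* Passing to K + 1 allows the use of n < b^(K+1), which turns q^(K+1) = (b^(K+1))^(-eta) into at
   most n^(-eta); the price is the factor 1/q. *)
apply: (@le_trans _ _ (2 * C / q * q ^+ K.+1)).
  rewrite exprS mulrA divfK ?gt_eqF //; nra.
rewrite ler_wpM2l //; first by rewrite divr_ge0 ?mulr_ge0 // ltW.
rewrite -powb -powR_mulrn ?powR_ge0 // -powRrM mulrC powRrM powR_mulrn ?(ltW b_gt0) //.
rewrite !powRN lef_pV2 ?posrE ?powR_gt0 ?exprn_gt0 //.
rewrite ge0_ler_powR ?nnegrE ?exprn_ge0 ?(ltW b_gt0) ?(ltW eta0) //.
by rewrite -natrX ler_nat ltnW.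
Qed.

Lemma polydecay_le p q : (forall n x, p n x <= q n x) ->
  polydecay q -> polydecay p.
Proof.
move=> pq [C C0 [eta heta H]]; exists C => //; exists eta => // n x n0.
exact: le_trans (pq n x) (H n x n0).
Qed.

Lemma polydecayD p q : polydecay p -> polydecay q ->
  polydecay (fun n x => p n x + q n x).
Proof.
move=> [C C0 [eta /andP[e0 e1] H]] [C' C0' [eta' /andP[e0' e1'] H']].
exists (C + C'); first exact: addr_ge0.
exists (Num.min eta eta'); first by rewrite lt_min e0 e0' ge_min e1.
move=> n x n0; have n1 : 1 <= n%:R :> R by rewrite ler1n.
rewrite mulrDl lerD //.
  apply: le_trans (H n x n0) _; rewrite ler_wpM2l // ler_powR // lerN2.
  by rewrite ge_min lexx.
apply: le_trans (H' n x n0) _; rewrite ler_wpM2l // ler_powR // lerN2.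
by rewrite ge_min lexx orbT.
Qed.

End PolynomialRate.

(** * One-sided annealed deviation bounds for the static walk *)

Section StaticRates.
Context {R : realType}.
Variables (alpha : probability (measurableTypeR R) R)
  (mu : probability (environment R) R).
Hypothesis Hmu : is_product_law alpha mu.
Variables (phi : R -> R) (c : R) (sigma : int -> int).
Hypothesis mphi : measurable_fun [set: measurableTypeR R] phi.
Hypothesis c0 : 0 < c.
Hypothesis phic : forall w, c <= phi w <= 1 - c.
Hypothesis sigma_inj : injective sigma.
Local Notation env := (env phi sigma).
Local Notation theta := (mean_rho alpha phi).
Local Notation mean_S := (mean_S alpha phi).
Local Notation B K := ((1 + 2 * c^-1) ^+ K).
Local Notation D := (10 * (1 + 2 * c^-1) ^+ 2).
Implicit Types (x y z : int) (K N n : nat).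

Definition annealed n x (F : seq bool -> R) : R :=
  Ex mu (fun omega : environment R => qE (fun=> env omega) n x F).

Definition solomon (th : R) : R :=
  if 1 <= th then 0 else (1 - th) / (1 + th).

Lemma theta_gt0 : 0 < theta.
Proof.
apply: (@lt_le_trans _ _ c) => //.
rewrite -[leLHS](Ex_cst alpha); apply: le_Ex.
- exact: bmf_cst.
- exact: (bmf_rho mphi c0 phic).
move=> w; have /andP[h1 h2] := phic w; have c_gt0 := c0.
have p0 : 0 < phi w by lra.
rewrite /rho ler_pdivlMr //.
have : c * phi w <= c * 1 by rewrite ler_wpM2l //; lra.
lra.
Qed.

Lemma B2_leD K : B K ^+ 2 <= D ^+ K.
Proof.
have B1 := B_ge1 c0 1; rewrite expr1 in B1.
rewrite -exprM mulnC exprM lerXn2r ?nnegrE ?sqr_ge0 //.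
  by rewrite mulr_ge0 ?sqr_ge0.
by rewrite ler_peMl ?sqr_ge0 // ler1n.
Qed.

Lemma D_ge1 : 1 <= D.
Proof. by apply: le_trans (B2_leD 1); rewrite exprn_ege1 // (B_ge1 c0). Qed.

Lemma annealed_upper K n N x (d : R) : (0 < n)%N -> 0 < d ->
  (1 + 2 * d) * n%:R <= N%:R * mean_S K ->
  annealed n x (fun s => (N%:Z <= pos s)%R%:R) <=
  (N%:R * D ^+ K + n%:R * B K ^+ 2) / (d * n%:R) ^+ 2.
Proof.
move=> n0 d0 hN.
have bd := bmfX 2 (bmf_dev alpha sigma mphi c0 phic K N x).
apply: (@le_trans _ _ (Ex mu (fun omega : environment R =>
  ((d * n%:R) ^+ 2)^-1 * (dev alpha phi sigma K N x omega ^+ 2 +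
    n%:R * B K ^+ 2)))).
  apply: le_Ex; first exact: (bmf_qE sigma mphi c0 phic).
    by apply: bmfM; [exact: bmf_cst|apply: bmfD => //; exact: bmf_cst].
  move=> omega; rewrite mulrC.
  exact: (upper_quenched c0 (env_elliptic sigma phic omega)).
rewrite ExZ; last by apply: bmfD => //; exact: bmf_cst.
rewrite ExD //; last exact: bmf_cst.
rewrite Ex_cst mulrC ler_wpM2r ?invr_ge0 ?sqr_ge0 // lerD2r.
exact: (Ex_dev2 Hmu mphi c0 phic sigma_inj).
Qed.

(** By [Ex_rf] each inner sum has a mean dominated by a geometric series, whose first term is of
    order theta^K. *)
Lemma Ex_green K y L : theta < 1 ->
  bmf (fun omega : environment R => green (env omega) K y L) /\
  Ex mu (fun omega : environment R => green (env omega) K y L) <=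
  L%:R * ((1 + theta) / (1 - theta) * theta ^+ K).
Proof.
move=> t1; have t0 := theta_ge0 alpha c0 phic.
have b := bmf_rf sigma mphi c0 phic.
have bi (i : 'I_L) : bmf (fun omega : environment R =>
    \sum_(m < L) rf (env omega) (K + m) (y + i%:Z + m%:Z)).
  by apply: bmf_sum => m; exact: b.
split; first exact: bmf_sum.
rewrite /green Ex_sum //.
rewrite -[L in leRHS](card_ord L) -sum1_card natr_sum mulr_suml.
apply: ler_sum => i _; rewrite mul1r Ex_sum; last by move=> m; exact: b.
under eq_bigr => m _ do
  rewrite (Ex_rf Hmu mphi c0 phic sigma_inj) exprD mulrA.
rewrite -mulr_sumr.
have h : (1 - theta) * \sum_(m < L) theta ^+ m <= 1.
  rewrite -opprB mulNr -subrX1 opprB lerBlDr lerDl exprn_ge0 //.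
have h1 : \sum_(m < L) theta ^+ m <= (1 - theta)^-1.
  by rewrite -[leRHS]mul1r ler_pdivlMr ?subr_gt0 // mulrC.
rewrite [leRHS]mulrAC ler_wpM2l // mulr_ge0 ?exprn_ge0 // addr_ge0 //.
Qed.

Lemma annealed_lower K n N x (d : R) : theta < 1 -> (0 < n)%N -> 0 < d ->
  N%:R * mean_S K <= (1 - 3 * d) * n%:R ->
  annealed n x (fun s => (pos s <= N%:Z)%R%:R) <=
  (N%:R * D ^+ K + n%:R * B K ^+ 2) / (d * n%:R) ^+ 2 +
  (2 * n).+1%:R * ((1 + theta) / (1 - theta) * theta ^+ K) / (d * n%:R).
Proof.
move=> t1 n0 d0 hN.
have dn : 0 < d * n%:R by rewrite mulr_gt0 // ltr0n.
have bd := bmfX 2 (bmf_dev alpha sigma mphi c0 phic K N x).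
have [bg hg] := Ex_green K (x - n%:Z) (2 * n).+1 t1.
have b1 : bmf (fun omega : environment R =>
  ((d * n%:R) ^+ 2)^-1 * (dev alpha phi sigma K N x omega ^+ 2 +
    n%:R * B K ^+ 2)).
  by apply: bmfM; [exact: bmf_cst|apply: bmfD => //; exact: bmf_cst].
have b2 : bmf (fun omega : environment R => (d * n%:R)^-1 *
    green (env omega) K (x - n%:Z) (2 * n).+1).
  by apply: bmfM => //; exact: bmf_cst.
apply: (@le_trans _ _ (Ex mu (fun omega : environment R =>
  ((d * n%:R) ^+ 2)^-1 * (dev alpha phi sigma K N x omega ^+ 2 +
    n%:R * B K ^+ 2) + (d * n%:R)^-1 *
    green (env omega) K (x - n%:Z) (2 * n).+1))).
  apply: le_Ex; [exact: (bmf_qE sigma mphi c0 phic)|exact: bmfD|].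
  move=> omega; rewrite mulrC [X in _ <= _ + X]mulrC.
  exact: (lower_quenched c0 (env_elliptic sigma phic omega)).
rewrite ExD // !ExZ //; last by apply: bmfD => //; exact: bmf_cst.
rewrite ExD //; last exact: bmf_cst.
rewrite Ex_cst; apply: lerD.
  rewrite mulrC ler_wpM2r ?invr_ge0 ?sqr_ge0 // lerD2r.
  exact: (Ex_dev2 Hmu mphi c0 phic sigma_inj).
by rewrite mulrC ler_wpM2r // invr_ge0 ltW.
Qed.

Lemma mean_S_geom K : (1 - theta) * mean_S K = (1 + theta) * (1 - theta ^+ K).
Proof.
elim: K => [|K IH]; first by rewrite /= subrr !mulr0.
transitivity ((1 - theta) * (1 + theta) + theta * ((1 - theta) * mean_S K)).
  by rewrite /=; ring.
by rewrite IH exprS; ring.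
Qed.

Lemma mean_S_ge0 K : 0 <= mean_S K.
Proof.
have t0 := theta_ge0 alpha c0 phic.
by elim: K => //= K IH; rewrite addr_ge0 ?mulr_ge0 // addr_ge0.
Qed.

(** For theta < 1 the means s_K tend to (1 + theta) / (1 - theta), the inverse of the speed; for
    theta >= 1 they are at least K. *)
Lemma mean_S_large (v : R) : solomon theta < v -> exists K, 1 < v * mean_S K.
Proof.
have t0 := theta_ge0 alpha c0 phic.
rewrite /solomon; case: (lerP 1 theta) => [t1 v0|t1 hv].
  have hS K : K%:R <= mean_S K.
    elim: K => [|K IH] //=; rewrite -natr1.
    have : mean_S K <= theta * mean_S K by rewrite ler_peMl // mean_S_ge0.
    lra.
  have [K hK] := nat_upper (v^-1 + 1); exists K.
  have : v^-1 < mean_S K by have := hS K; lra.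
  by rewrite -ltr_pdivrMl // mulr1.
have v0 : 0 < v by apply: le_lt_trans hv; rewrite divr_ge0 ?subr_ge0 ?addr_ge0 // ltW.
have p1 : 0 < 1 + theta by rewrite ltr_wpDr.
have hv' : 1 - theta < v * (1 + theta) by rewrite -ltr_pdivrMr.
have vp : 0 < v * (1 + theta) by rewrite mulr_gt0.
have [K hK] : exists K,
    theta ^+ K < (v * (1 + theta) - (1 - theta)) / (v * (1 + theta)).
  by apply: expr_small; rewrite ?t0 ?t1 // divr_gt0 // subr_gt0.
exists K; move: hK; rewrite ltr_pdivlMr // => hK.
have m0 : 0 < 1 - theta by rewrite subr_gt0.
rewrite -(ltr_pM2l m0) mulr1 mulrCA mean_S_geom mulrA.
lra.
Qed.

Lemma solomon_ge0 (th : R) : 0 <= th -> 0 <= solomon th.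
Proof.
move=> th0; rewrite /solomon; case: (lerP 1 th) => // th1.
by rewrite divr_ge0 ?subr_ge0 ?addr_ge0 // ltW.
Qed.

Lemma le_annealed n x F1 F2 : (forall s, F1 s <= F2 s) ->
  annealed n x F1 <= annealed n x F2.
Proof.
move=> F12; apply: le_Ex; try exact: (bmf_qE sigma mphi c0 phic).
move=> omega; apply: le_qE => // i z.
exact: (elliptic01 c0 (env_elliptic sigma phic omega)).
Qed.

(** One fixed K suffices: the second moments are O(n), and Chebyshev's inequality divides them by
    n^2. *)
Lemma upper_rate (eps : R) : 0 < eps ->
  polydecay (fun n x =>
    annealed n x (fun s => ((solomon theta + eps) * n%:R <= (pos s)%:~R)%R%:R)).
Proof.
move=> e0; set v := solomon theta + eps.
have v0 : 0 < v by rewrite ltr_wpDl // solomon_ge0 // (theta_ge0 alpha c0 phic).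
have [K hK] : exists K, 1 < v * mean_S K.
  by apply: mean_S_large; rewrite ltrDl.
(* Chosen so that 1 + 2 d = v s_K. *)
pose d := (v * mean_S K - 1) / 2.
have d0 : 0 < d by rewrite divr_gt0 // subr_gt0.
pose C := ((v + 1) * D ^+ K + B K ^+ 2) / d ^+ 2.
have D0 : 0 <= D ^+ K by rewrite exprn_ge0 // (le_trans _ D_ge1).
apply: (@polydecay_inv _ _ _ C).
  by rewrite divr_ge0 ?sqr_ge0 // addr_ge0 ?sqr_ge0 // mulr_ge0 // ltW // addr_gt0.
move=> n x n0; have n_gt0 : 0 < n%:R :> R by rewrite ltr0n.
have n1 : 1 <= n%:R :> R by rewrite ler1n.
pose N := `|Num.ceil (v * n%:R)|%N.
have cN : Num.ceil (v * n%:R) = N%:Z.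
  rewrite /N gez0_abs // ceil_ge0 (lt_trans (ltrN10 R)) // mulr_gt0 //.
have N1 : v * n%:R <= N%:R.
  by have := ceil_ge (v * n%:R); rewrite cN.
have N2 : N%:R <= (v + 1) * n%:R.
  by have := ceilB1_lt (v * n%:R); rewrite cN intrB; lra.
apply: le_trans (le_annealed _ _ _) _; last first.
  apply: (le_trans (annealed_upper (N := N) (K := K) x n0 d0 _)).
    rewrite /d (_ : 1 + 2 * _ = v * mean_S K); last by field.
    by rewrite mulrAC ler_wpM2r // mean_S_ge0.
  rewrite -subr_ge0.
  have -> : C / n%:R - (N%:R * D ^+ K + n%:R * B K ^+ 2) / (d * n%:R) ^+ 2 =
    ((v + 1) * n%:R - N%:R) * D ^+ K / (d * n%:R) ^+ 2.
    by rewrite /C; field; rewrite !gt_eqF.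
  by rewrite divr_ge0 ?sqr_ge0 // mulr_ge0 // subr_ge0.
move=> s; rewrite ler_nat; case: (boolP (v * n%:R <= _)) => // h.
by rewrite -cN ceil_le_int h.
Qed.

(** The bound is of order D^K / n + theta^K with constants free of K, so K can grow with n as in
    [polydecay_opt]. *)
Lemma lower_rate (eps : R) : theta < 1 -> 0 < eps ->
  polydecay (fun n x =>
    annealed n x (fun s => ((pos s)%:~R <= (solomon theta - eps) * n%:R)%R%:R)).
Proof.
move=> t1 e0; set v := solomon theta.
have t0 := theta_gt0.
have ve : v = (1 - theta) / (1 + theta) by rewrite /v /solomon leNgt t1.
have v0 : 0 < v by rewrite ve divr_gt0 ?subr_gt0 ?addr_gt0.
(* Lowering eps to v keeps (v - e) n nonnegative, so that its floor is a natural number; this only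
   enlarges the event. *)
pose e := Num.min eps v.
have e_gt0 : 0 < e by rewrite lt_min e0 v0.
(* Chosen so that 1 - 3 d = (v - e) / v; s_K is at most 1 / v. *)
pose d := e / (3 * v).
have d0 : 0 < d by rewrite divr_gt0 ?mulr_gt0.
pose r := (1 + theta) / (1 - theta).
have r0 : 0 <= r by rewrite divr_ge0 ?subr_ge0 ?addr_ge0 // ltW.
pose C1 := 2 / d ^+ 2; pose C2 := 3 * r / d.
have C1_ge0 : 0 <= C1 by rewrite divr_ge0 ?sqr_ge0.
have C2_ge0 : 0 <= C2 by apply: divr_ge0 (mulr_ge0 _ r0) (ltW d0).
apply: (polydecay_opt (C := C1 + C2) (D := D) (q := theta)).
- exact: addr_ge0.
- exact: D_ge1.
- by rewrite t0 t1.
move=> K n x n0; have n_gt0 : 0 < n%:R :> R by rewrite ltr0n.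
have n1 : 1 <= n%:R :> R by rewrite ler1n.
have a0 : 0 <= (v - e) * n%:R by rewrite mulr_ge0 // subr_ge0 ge_min lexx orbT.
pose N := `|Num.floor ((v - e) * n%:R)|%N.
have fN : Num.floor ((v - e) * n%:R) = N%:Z by rewrite /N gez0_abs // floor_ge0.
have N1 : N%:R <= (v - e) * n%:R.
  by have := floor_le ((v - e) * n%:R); rewrite fN.
have v1 : v <= 1.
  by rewrite ve ler_pdivrMr ?addr_gt0 // mul1r; lra.
have D0 : 0 <= D ^+ K by rewrite exprn_ge0 // (le_trans _ D_ge1).
have tK : 0 <= theta ^+ K by rewrite exprn_ge0 // ltW.
apply: le_trans (le_annealed _ _ _) _; last first.
  apply: (le_trans (annealed_lower (N := N) (K := K) x t1 n0 d0 _)).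
    apply: (@le_trans _ _ ((v - e) * n%:R * v^-1)).
      rewrite ler_pM ?mean_S_ge0 // ve invf_div ler_pdivlMr ?subr_gt0 //.
      rewrite mulrC mean_S_geom ler_piMr ?addr_ge0 ?(ltW t0) // gerBl.
      exact: tK.
    rewrite /d le_eqVlt; apply/orP; left; apply/eqP.
    by field; rewrite gt_eqF.
  rewrite [leRHS]mulrDr; apply: lerD.
    apply: (@le_trans _ _ (C1 * (D ^+ K / n%:R))).
      rewrite /C1 (_ : 2 / d ^+ 2 * _ = (n%:R * D ^+ K + n%:R * D ^+ K) /
        (d * n%:R) ^+ 2); last by field; rewrite !gt_eqF.
      rewrite ler_wpM2r ?invr_ge0 ?sqr_ge0 // lerD //.
        rewrite ler_wpM2r // (le_trans N1) // ler_piMl //.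
        by rewrite lerBlDr (le_trans v1) // lerDl ltW.
      by rewrite ler_wpM2l // B2_leD.
    rewrite ler_wpM2r ?divr_ge0 // lerDl //.
  apply: (@le_trans _ _ (C2 * theta ^+ K)); last first.
    by rewrite ler_wpM2r // lerDr.
  rewrite /C2 (_ : 3 * r / d * _ = (3 * n%:R) * (r * theta ^+ K) / (d * n%:R));
    last by field; rewrite !gt_eqF.
  rewrite ler_wpM2r ?invr_ge0 ?(ltW (mulr_gt0 _ _)) //.
  have h3 : (2 * n).+1%:R <= 3 * n%:R :> R by rewrite -natr1 natrM; lra.
  by rewrite ler_wpM2r // mulr_ge0.
move=> s; rewrite ler_nat; case: (boolP (_ <= (v - eps) * n%:R)) => // h.
rewrite -fN floor_ge_int (le_trans h) // ler_wpM2r // lerD2l lerN2.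
by rewrite ge_min lexx.
Qed.

End StaticRates.

(** * The speed *)

Section Support.
Context {R : realType}.
Variable alpha : probability (measurableTypeR R) R.

(** Every point outside the support lies in a null interval with rational endpoints, and there are
    countably many of these. *)
Lemma negligible_outside_support :
  alpha.-negligible (~` topological_support alpha).
Proof.
pose F (k : nat) : set (measurableTypeR R) :=
  if unpickle k is Some p then
    let U := `](ratr p.1 : R), (ratr p.2 : R)[%classic in
    if (alpha U == 0)%E then U else set0
  else set0.
suff sub : ~` topological_support alpha `<=` \bigcup_k F k.
  have [N [mN N0 FN]] : alpha.-negligible (\bigcup_k F k).
    apply: negligible_bigcup => k; rewrite /F.
    case: unpickle => [p|]; last exact: negligible_set0.
    case: ifPn => [/eqP h|_]; last exact: negligible_set0.
    by apply/negligibleP => //; exact: measurable_itv.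
  by exists N; split => //; exact: subset_trans FN.
move=> x /= /existsNP[U /not_implyP[oU /not_implyP[Ux aU]]].
have /nbhs_ballP[e /= e0 eU] : nbhs x U by apply: open_nbhs_nbhs.
have [a ha] : exists a : rat, ratr a \in `]x - e, x[.
  by have [|a ?] := @rat_in_itvoo R (x - e) x; [rewrite gtrBl|exists a].
have [b hb] : exists b : rat, ratr b \in `]x, x + e[.
  by have [|b ?] := @rat_in_itvoo R x (x + e); [rewrite ltrDl|exists b].
move: ha hb; rewrite !in_itv /= => /andP[a1 a2] /andP[b1 b2].
have sub : `](ratr a : R), (ratr b : R)[%classic `<=` U.
  move=> y /=; rewrite in_itv /= => /andP[y1 y2]; apply: eU.
  by rewrite /ball /= ltr_norml; apply/andP; split; lra.
have [k kE] : exists k, unpickle k = Some (a, b).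
  by exists (pickle (a, b)); exact: pickleK.
exists k; first exact: I.
rewrite /F kE /=.
have -> : alpha `](ratr a : R), (ratr b : R)[%classic = 0%E.
  apply/eqP; rewrite -measure_le0 leNgt; apply/negP => h; apply: aU.
  apply: lt_le_trans h _; apply: le_measure => //; rewrite inE.
    exact: measurable_itv.
  exact: open_measurable.
by rewrite eqxx /= in_itv /= a2 b1.
Qed.

End Support.

(** * Clipping to the ellipticity interval *)

Section Clip.
Context {R : realType}.
Variable c : R.
Hypothesis c0 : 0 < c.
Hypothesis c12 : c <= 1 - c.

(** Turns almost sure ellipticity into ellipticity everywhere, while changing the environment only
    on a null set. *)
Definition clip (w : R) : R := Num.max c (Num.min w (1 - c)).

Lemma clip_itv w : c <= clip w <= 1 - c.
Proof. by rewrite /clip le_max lexx /= ge_max c12 ge_min lexx orbT. Qed.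

Lemma clip_id w : c <= w <= 1 - c -> clip w = w.
Proof.
by move=> /andP[h1 h2]; rewrite /clip (min_idPl h2) (max_idPr h1).
Qed.

Lemma clipC_itv w : c <= 1 - clip w <= 1 - c.
Proof.
by have /andP[h1 h2] := clip_itv w; apply/andP; split; lra.
Qed.

Lemma measurable_clip : measurable_fun setT (clip : measurableTypeR R -> R).
Proof.
by apply: measurable_maxr => //; apply: measurable_minr.
Qed.

Lemma measurable_clipC :
  measurable_fun setT ((fun w => 1 - clip w) : measurableTypeR R -> R).
Proof. by apply: measurable_funB => //; exact: measurable_clip. Qed.

Lemma rho_clipC w : rho (1 - clip w) = (rho (clip w))^-1.
Proof. by rewrite /rho subKr invf_div. Qed.

End Clip.

Lemma measurable_rho (R : realType) :
  measurable_fun setT (@rho R : measurableTypeR R -> R).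
Proof.
have mV : measurable_fun setT ((fun w => w^-1) : measurableTypeR R -> R).
  (* The inverse is an odd function, given by a power on each half-line; at 0 both sides take the
     default value 0. *)
  rewrite (_ : (fun _ => _) =
      (fun w : R => if 0 < w then w `^ (-1) else - ((- w) `^ (-1)))).
    apply: measurable_fun_ifT => //.
    - exact: measurable_fun_ltr.
    - have mN : measurable_fun setT ((fun w => - w) : measurableTypeR R -> R).
        have := @measurable_funN _ (measurableTypeR R) R setT id.
        by apply; exact: measurable_id.
      have mP := measurableT_comp (measurable_powR (-1)) mN.
      exact: (measurable_funN mP).
  apply/funext => w; case: ltP => w0; first by rewrite powR_inv1 // ltW.
  by rewrite powR_inv1 ?oppr_ge0 // invrN opprK.
by apply: measurable_funM => //; exact: measurable_funB.
Qed.

Lemma le_indic (R : realType) (a b : bool) : (a -> b) -> a%:R <= b%:R :> R.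
Proof. by case: a => [/(_ isT) ->|]. Qed.

(** * Two-sided deviation bounds around the speed *)

Section SpeedRate.
Context {R : realType}.
Variables (alpha : probability (measurableTypeR R) R)
  (mu : probability (environment R) R).
Hypothesis Hmu : is_product_law alpha mu.
Variable c : R.
Hypothesis c0 : 0 < c.
Hypothesis c12 : c <= 1 - c.
Hypothesis Hc : alpha.-negligible (~` [set w : R | c <= w <= 1 - c]).
Local Notation phi1 := (clip c).
Local Notation phi2 := (fun w : R => 1 - clip c w).
Local Notation th1 := (mean_rho alpha phi1).
Local Notation th2 := (mean_rho alpha phi2).
Let m1 := @measurable_clip R c.
Let m2 := @measurable_clipC R c.
Let e1 := clip_itv c12.
Let e2 := clipC_itv c12.
Local Notation mean_ln := (Ex alpha (fun w => ln (rho (clip c w)))).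

Lemma expectation_clip (h h' : measurableTypeR R -> R) :
  measurable_fun setT h -> bmf h' ->
  (forall w, c <= w <= 1 - c -> h w = h' w) ->
  ('E_alpha[h] = (Ex alpha h')%:E)%E.
Proof.
move=> mh bh' hh'; rewrite unlock EFin_Ex //.
apply: ae_eq_integral => //.
- exact/measurable_EFinP.
- by apply/measurable_EFinP; case: bh'.
have [N [mN N0 sN]] := Hc; exists N; split => //.
apply: subset_trans sN => w /= H K; apply: H => _.
by rewrite hh'.
Qed.

(** Both ln r < r and - ln r < 1 / r, and r and 1 / r are at most 1 / c. *)
Lemma bmf_ln_rho : bmf (fun w : measurableTypeR R => ln (rho (clip c w))).
Proof.
have [mr _] := bmf_rho m1 c0 e1.
have r_gt0 w : 0 < rho (clip c w).
  have /andP[h1 h2] := e1 w; have c_gt0 := c0.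
  by rewrite /rho divr_gt0 //; lra.
have r2 w : 0 < rho (1 - clip c w) by rewrite rho_clipC invr_gt0.
split; first exact: (measurableT_comp (@measurable_ln R) mr).
exists c^-1 => w.
have k1 := rho_le c0 (u := fun=> clip c w) (fun=> e1 w) 0.
have k2 := rho_le c0 (u := fun=> 1 - clip c w) (fun=> e2 w) 0.
have h1 : ln (rho (clip c w)) <= rho (clip c w) by rewrite ltW // ln_sublinear.
have h2 : - ln (rho (clip c w)) <= rho (1 - clip c w).
  by rewrite rho_clipC -lnV ?posrE // ltW // ln_sublinear // invr_gt0.
by rewrite ler_norml; apply/andP; split; lra.
Qed.

(** From 1 + ln r <= r for r = rho and r = 1 / rho. Thus th1 and th2 are never both below 1, and the
    sign of the mean logarithm tells which one may be. *)
Lemma mean_rho_ge : 1 + mean_ln <= th1 /\ 1 - mean_ln <= th2.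
Proof.
have r_gt0 w : 0 < rho (clip c w).
  have /andP[h1 h2] := e1 w; have c_gt0 := c0.
  by rewrite /rho divr_gt0 //; lra.
have ln_le (r : R) : 0 < r -> 1 + ln r <= r.
  move=> r0; have := @le_ln1Dx R (r - 1).
  rewrite (_ : 1 + (r - 1) = r); [lra|ring].
have bl := bmf_ln_rho.
have bN : bmf (fun w : measurableTypeR R => -1 * ln (rho (clip c w))).
  by apply: bmfM => //; exact: bmf_cst.
split.
  rewrite -[X in X + _](Ex_cst alpha) -ExD //; last exact: bmf_cst.
  apply: le_Ex; last by move=> w; exact: ln_le.
    by apply: bmfD => //; exact: bmf_cst.
  exact: (bmf_rho m1 c0 e1).
rewrite -[X in X - _](Ex_cst alpha) -mulN1r -ExZ // -ExD //; last exact: bmf_cst.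
apply: le_Ex.
- by apply: bmfD => //; exact: bmf_cst.
- exact: (bmf_rho m2 c0 e2).
- by move=> w; rewrite rho_clipC mulN1r -lnV ?posrE // ln_le // invr_gt0.
Qed.

Lemma speed_clip : speed alpha =
  if mean_ln <= 0 then solomon th1 else - solomon th2.
Proof.
rewrite /speed.
have mr : measurable_fun setT (@rho R : measurableTypeR R -> R).
  exact: measurable_rho.
have -> : ('E_alpha[fun w : R => ln (rho w)] = mean_ln%:E)%E.
  apply: expectation_clip; [|exact: bmf_ln_rho|].
    exact: (measurableT_comp (@measurable_ln R) mr).
  by move=> w hw; rewrite clip_id.
have -> : ('E_alpha[@rho R] = th1%:E)%E.
  apply: expectation_clip => //; first exact: (bmf_rho m1 c0 e1).
  by move=> w hw; rewrite clip_id.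
have mr' : measurable_fun setT
    ((fun w => (rho w)^-1) : measurableTypeR R -> R).
  rewrite (_ : (fun _ => _) = @rho R \o (fun w : R => 1 - w)).
    by apply: measurableT_comp => //; exact: measurable_funB.
  by apply/funext => w; rewrite /= /rho subKr invf_div.
have -> : ('E_alpha[fun w : R => ((rho w)^-1)%R] = th2%:E)%E.
  apply: expectation_clip => //; first exact: (bmf_rho m2 c0 e2).
  by move=> w hw; rewrite rho_clipC clip_id.
by rewrite /right_speed !lee_fin.
Qed.

Lemma annealed_reflect n x F : annealed mu phi1 id n x F =
  annealed mu phi2 -%R n (- x) (fun s => F (map negb s)).
Proof.
by rewrite /annealed; congr Ex; apply/funext => omega; apply: qE_opp.
Qed.

Lemma pos_negb s : pos (map negb s) = - pos s.
Proof.
elim: s => [|b s IH]; first by rewrite pos_nil oppr0.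
rewrite [map _ _]/= !pos_cons IH opprD; congr (_ + _); by case: b.
Qed.

Lemma polydecay_opp (p : nat -> int -> R) :
  polydecay p -> polydecay (fun n x => p n (- x)).
Proof. by move=> [C C0 [eta he H]]; exists C => //; exists eta => // n x; exact: H. Qed.

Lemma two_sided_rate (v eps : R) :
  polydecay (fun n x => annealed mu phi1 id n x
    (fun s => ((v + eps) * n%:R <= (pos s)%:~R)%R%:R)) ->
  polydecay (fun n x => annealed mu phi1 id n x
    (fun s => ((pos s)%:~R <= (v - eps) * n%:R)%R%:R)) ->
  polydecay (fun n x => annealed mu phi1 id n x
    (fun s => (eps * n%:R <= `|(pos s)%:~R - v * n%:R|)%R%:R)).
Proof.
move=> H1 H2; apply: polydecay_le (polydecayD H1 H2) => n x.
rewrite -ExD; try exact: (bmf_qE id m1 c0 e1).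
apply: le_Ex; first exact: (bmf_qE id m1 c0 e1).
  by apply: bmfD; exact: (bmf_qE id m1 c0 e1).
move=> omega; rewrite -qED; apply: le_qE => [_ z|s _].
  exact: (elliptic01 c0 (env_elliptic id e1 omega)).
rewrite -natrD ler_nat; case: lerP => //=.
rewrite ler_normr => /orP[h|h].
  by rewrite (_ : (v + eps) * _ <= _) //; lra.
by rewrite (_ : _ <= (v - eps) * _) ?addn1 //; lra.
Qed.

Lemma opp_inj_int : injective (-%R : int -> int).
Proof. exact: oppr_inj. Qed.

Lemma static_rate (eps : R) : 0 < eps ->
  polydecay (fun n x => annealed mu phi1 id n x
    (fun s => (eps * n%:R <= `|(pos s)%:~R - speed alpha * n%:R|)%R%:R)).
Proof.
move=> eps0; have id_inj : injective (@id int) by [].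
have U1 := upper_rate Hmu m1 c0 e1 id_inj eps0.
(* The upper bound for the reflected walk limits how far the walk goes to the left. *)
have U2 : polydecay (fun n x => annealed mu phi1 id n x
    (fun s => ((pos s)%:~R <= (- solomon th2 - eps) * n%:R)%R%:R)).
  apply: polydecay_le (polydecay_opp (upper_rate Hmu m2 c0 e2 opp_inj_int eps0)).
  move=> n x; rewrite annealed_reflect; apply: (le_annealed mu -%R m2 c0 e2) => s.
  by apply: le_indic; rewrite pos_negb intrN; lra.
have [g1 g2] := mean_rho_ge.
rewrite speed_clip; case: lerP => hln.
  apply: two_sided_rate => //.
  have [t1|t1] := ltP th1 1; first exact: (lower_rate Hmu m1 c0 e1 id_inj).
  (* Zero speed: both means are at least 1, and the two upper bounds squeeze the walk. *)
  have -> : solomon th1 = - solomon th2.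
    by rewrite /solomon t1 ifT ?oppr0 //; lra.
  exact: U2.
apply: two_sided_rate => //.
have [t2|t2] := ltP th2 1; last first.
  have <- : solomon th1 = - solomon th2.
    by rewrite /solomon t2 ifT ?oppr0 //; lra.
  exact: U1.
apply: polydecay_le
  (polydecay_opp (lower_rate Hmu m2 c0 e2 opp_inj_int t2 eps0)).
move=> n x; rewrite annealed_reflect; apply: (le_annealed mu -%R m2 c0 e2) => s.
by apply: le_indic; rewrite pos_negb intrN; lra.
Qed.

End SpeedRate.

(** * Walks in successive blocks *)

Section Enumeration.
Context {R : realType}.
Implicit Types (w : nat -> int -> R) (F : seq bool -> R) (s : seq bool).

Fixpoint walks n : seq (seq bool) :=
  if n is n'.+1 then
    [seq true :: s | s <- walks n'] ++ [seq false :: s | s <- walks n']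
  else [:: [::]].

Lemma mem_walks n s : (s \in walks n) = (size s == n).
Proof.
elim: n s => [|n IH] [|b s] //=.
  by rewrite mem_cat; apply/negbTE/negP => /orP[] /mapP[].
rewrite mem_cat eqSS -IH; apply/orP/idP => [[] /mapP[s' h [_ ->]] //|h].
by case: b; [left|right]; apply/mapP; exists s.
Qed.

Definition jump (p : R) (b : bool) : R := if b then p else 1 - p.

Fixpoint weight w (x : int) s : R :=
  if s is b :: s' then
    jump (w 0%N x) b * weight (fun i => w i.+1) (x + step b) s'
  else 1.

(** Separates the environment, which enters through the weights, from the functional; integrals over
    the environment can then be taken term by term. *)
Lemma qE_sum w n x F :
  qE w n x F = \sum_(s <- walks n) weight w x s * F s.
Proof.
elim: n w x F => [|n IH] w x F /=; first by rewrite big_seq1 mul1r.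
rewrite big_cat !big_map !IH !mulr_sumr /=.
by congr (_ + _); apply: eq_bigr => s _; rewrite mulrA.
Qed.

Lemma weight_ge0 w x s : (forall i z, 0 <= w i z <= 1) -> 0 <= weight w x s.
Proof.
elim: s w x => [|b s IH] w x w01 //=; have /andP[h0 h1] := w01 0%N x.
by rewrite mulr_ge0 ?IH // /jump; case: b => //; rewrite subr_ge0.
Qed.

End Enumeration.

(** * Walks made of blocks, and the total length of bad blocks *)

Section Blocks.
Context {R : realType}.
Implicit Types (w u : nat -> int -> R) (F : seq bool -> R) (s : seq bool).
Implicit Types (ts : seq nat).

Fixpoint bE u ts x F : R :=
  if ts is t :: ts' then
    qE (fun=> u 0%N) t x (fun s => bE (fun j => u j.+1) ts' (x + pos s)
                                     (fun s' => F (s ++ s')))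
  else F [::].

Fixpoint agree w u ts : Prop :=
  if ts is t :: ts' then
    (forall i, (i < t)%N -> w i = u 0%N) /\
    agree (fun i => w (t + i)%N) (fun j => u j.+1) ts'
  else True.

Lemma qE_bE w u ts x F : agree w u ts -> qE w (sumn ts) x F = bE u ts x F.
Proof.
elim: ts w u x F => [|t ts IH] w u x F //= [h1 h2].
rewrite qE_cat (@eq_qE_env _ _ (fun=> u 0%N)); last first.
  by move=> i z it; rewrite h1.
by apply: eq_qE => s _; exact: IH.
Qed.

Lemma eq_bE u ts x F1 F2 : (forall s, size s = sumn ts -> F1 s = F2 s) ->
  bE u ts x F1 = bE u ts x F2.
Proof.
elim: ts u x F1 F2 => [|t ts IH] u x F1 F2 H /=; first exact: H.
apply: eq_qE => s hs; apply: IH => s' hs'; apply: H.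
by rewrite size_cat hs hs'.
Qed.

Lemma le_bE u ts x F1 F2 : (forall i z, 0 <= u i z <= 1) ->
  (forall s, size s = sumn ts -> F1 s <= F2 s) -> bE u ts x F1 <= bE u ts x F2.
Proof.
elim: ts u x F1 F2 => [|t ts IH] u x F1 F2 u01 H /=; first exact: H.
apply: le_qE => // s hs; apply: IH => // s' hs'; apply: H.
by rewrite size_cat hs hs'.
Qed.

Lemma bEZ u ts x (a : R) F : bE u ts x (fun s => a * F s) = a * bE u ts x F.
Proof.
elim: ts u x F => [|t ts IH] u x F //=.
by rewrite -qEZ; apply: eq_qE => s _; exact: IH.
Qed.

Variables (v eps : R).

Definition bad_length t s : R :=
  t%:R * (eps * t%:R <= `|(pos s)%:~R - v * t%:R|)%R%:R.

Fixpoint bad_total ts s : R :=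
  if ts is t :: ts' then bad_length t (take t s) + bad_total ts' (drop t s)
  else 0.

(** A good block of length t contributes at most eps t; a bad one at most (1 + |v|) t, since the
    walk moves at most t. *)
Lemma bad_total_dev ts s : 0 <= eps -> size s = sumn ts ->
  `|(pos s)%:~R - v * (sumn ts)%:R| <=
  eps * (sumn ts)%:R + (1 + `|v|) * bad_total ts s.
Proof.
move=> e0; elim: ts s => [|t ts IH] s hs /=.
  by rewrite (size0nil hs) pos_nil !mulr0 subrr normr0 addr0.
have hs1 : size (take t s) = t.
  by rewrite size_takel // hs /= leq_addr.
have hs2 : size (drop t s) = sumn ts by rewrite size_drop hs /= addKn.
have h := IH _ hs2.
rewrite -{1}(cat_take_drop t s) pos_cat natrD intrD.
set a := (pos (take t s))%:~R; set b := (pos (drop t s))%:~R in h *.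
rewrite (_ : a + b - _ = (a - v * t%:R) + (b - v * (sumn ts)%:R)); last by ring.
apply: (le_trans (ler_normD _ _)).
rewrite (_ : eps * _ + _ = (eps * t%:R + (1 + `|v|) * bad_length t (take t s)) +
  (eps * (sumn ts)%:R + (1 + `|v|) * bad_total ts (drop t s))); last by ring.
apply: lerD => //; rewrite /bad_length -/a.
case: (lerP (eps * t%:R)) => [_|/ltW h1]; last by rewrite !mulr0 addr0.
rewrite mulr1; apply: (@le_trans _ _ ((1 + `|v|) * t%:R)); last first.
  by rewrite lerDr mulr_ge0.
apply: (le_trans (ler_normB _ _)); rewrite mulrDl mul1r normrM.
rewrite [`|t%:R|]ger0_norm // lerD2r.
have := pos_bound (take t s); rewrite hs1 /a -intr_norm.
by rewrite -(ler_int R).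
Qed.

(** The positive part is taken because only an upper bound p on the bad probability is known: the
    linear coefficient 2 a_+ in [sqposD] is nonnegative, so overestimating the mean does no harm. *)
Definition sqpos (a : R) : R := Num.max a 0 ^+ 2.

Lemma sqposD (a b : R) : sqpos (a + b) <= sqpos a + 2 * Num.max a 0 * b + b ^+ 2.
Proof.
rewrite /sqpos; case: (lerP a 0) => ha; case: (lerP (a + b) 0) => hab.
- by rewrite !(expr0n, mulr0, mul0r) /= !add0r sqr_ge0.
- rewrite expr0n mulr0 mul0r /= !add0r.
  rewrite lerXn2r ?nnegrE; lra.
- rewrite expr0n /=; have := sqr_ge0 (a + b); nra.
- by rewrite le_eqVlt; apply/orP; left; apply/eqP; ring.
Qed.

End Blocks.

(** * Second moment of the bad length under fresh environments *)

Section AnnealedBlocks.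
Context {R : realType}.
Variables (mu : probability (environment R) R)
  (muN : probability (product_space nat (environment R)) R).
Hypothesis HmuN : is_product_law mu muN.
Variables (phi : R -> R) (c : R) (sigma : int -> int).
Hypothesis mphi : measurable_fun [set: measurableTypeR R] phi.
Hypothesis c0 : 0 < c.
Hypothesis phic : forall w, c <= phi w <= 1 - c.
Local Notation env := (env phi sigma).
Local Notation PS := (product_space nat (environment R)).

Definition envs (Omega : nat -> environment R) : nat -> int -> R :=
  fun j => env (Omega j).

Lemma envs01 (Omega : PS) i z : 0 <= envs Omega i z <= 1.
Proof. exact: (elliptic01 c0 (env_elliptic sigma phic (Omega i))). Qed.

Lemma bmf_weight x s :
  bmf (fun omega : environment R => weight (fun i => env omega) x s).
Proof.
elim: s x => [|b s IH] x /=; first exact: bmf_cst.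
apply: bmfM => //; have b1 : bmf (fun omega : environment R => env omega x).
  by apply: bmf_comp (bmf_phi mphi c0 phic); exact: measurable_coord.
by case: b => //=; apply: bmfB => //; exact: bmf_cst.
Qed.

Lemma bmf_bE ts x F j0 :
  bmf (fun Omega : PS => bE (fun j => envs Omega (j0 + j)) ts x F).
Proof.
elim: ts x F j0 => [|t ts IH] x F j0 /=; first exact: bmf_cst.
rewrite addn0 (_ : (fun _ => _) = (fun Omega : PS => \sum_(s <- walks t)
   weight (fun=> env (Omega j0)) x s *
   bE (fun j => envs Omega (j0.+1 + j)) ts (x + pos s) (fun s' => F (s ++ s')))).
  apply: bmf_sum => s; apply: bmfM => //.
  apply: (bmf_comp (g := fun Omega : PS => Omega j0) _ (bmf_weight x s)).
  exact: measurable_coord.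
apply/funext => Omega; rewrite qE_sum; apply: eq_bigr => s _.
by congr (_ * bE _ _ _ _); apply/funext => j; rewrite addSnnS.
Qed.

Variables (v eps : R) (p : nat -> R).
Hypothesis p01 : forall t, 0 <= p t <= 1.
Hypothesis pP : forall t x, (0 < t)%N ->
  annealed mu phi sigma t x
    (fun s => (eps * t%:R <= `|(pos s)%:~R - v * t%:R|)%R%:R) <= p t.

Definition mean_bad ts : R := \sum_(t <- ts) t%:R * p t.
Definition var_bad ts : R := \sum_(t <- ts) 2 * (t%:R ^+ 2 * p t).

(** With m = t p, the linear term has mean at most 0, and the square has mean at most t^2 p + m^2 <=
    2 t^2 p. *)
Lemma Ex_block_step t x (a : R) :
  annealed mu phi sigma t x
    (fun s => sqpos (a + (bad_length v eps t s - t%:R * p t))) <=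
  sqpos a + 2 * (t%:R ^+ 2 * p t).
Proof.
have u01 omega := elliptic01 c0 (env_elliptic sigma phic omega).
have [t0|t0] := posnP t.
  rewrite t0 /annealed /= /bad_length !mul0r subrr addr0 expr0n mul0r mulr0 addr0.
  by rewrite Ex_cst.
set I := fun s => (eps * t%:R <= `|(pos s)%:~R - v * t%:R|)%R%:R : R.
have /andP[p0 p1] := p01 t.
set m := t%:R * p t; set a' := Num.max a 0.
have a'0 : 0 <= a' by rewrite /a' le_max lexx orbT.
have m0 : 0 <= m by rewrite mulr_ge0.
(* A + B I bounds the expansion in [sqposD], I being the indicator of a bad block; the term - 2 t m
   I is dropped. *)
pose A := sqpos a + m ^+ 2 - 2 * a' * m.
pose B := 2 * a' * t%:R + t%:R ^+ 2.
have bq : bmf (fun omega : environment R => qE (fun=> env omega) t x I).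
  exact: (bmf_qE sigma mphi c0 phic).
apply: (@le_trans _ _ (A + B * annealed mu phi sigma t x I)).
  rewrite /annealed -ExZ // -[X in X + _](Ex_cst mu) -ExD //; last 2 first.
  - exact: bmf_cst.
  - by apply: bmfM => //; exact: bmf_cst.
  apply: le_Ex; first exact: (bmf_qE sigma mphi c0 phic).
    by apply: bmfD; [exact: bmf_cst|apply: bmfM => //; exact: bmf_cst].
  move=> omega; rewrite -qEZ -{1}(qE_cst (fun=> env omega) t x A) -qED.
  apply: le_qE => [_ z|s _]; first exact: u01.
  apply: (le_trans (sqposD _ _)); rewrite /bad_length -/(I s) -/a' /A /B.
  have tm : 0 <= t%:R * m by rewrite mulr_ge0.
  rewrite /I; case: (eps * t%:R <= _) => /=; lra.
have hp := pP x t0.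
have B0 : 0 <= B by rewrite addr_ge0 ?sqr_ge0 // !mulr_ge0.
apply: (@le_trans _ _ (A + B * p t)); first by rewrite lerD2l ler_wpM2l.
have : m ^+ 2 <= t%:R ^+ 2 * p t.
  by rewrite exprMn ler_wpM2l ?sqr_ge0 // expr2 ler_piMl.
rewrite /A /B /m; lra.
Qed.

(** Induction on the blocks, with a the excess accumulated so far. The weights of the first block
    depend on environment j0 only and the remainder on later ones, so the two factorise; the
    induction hypothesis is uniform in the position reached. *)
Lemma Ex_blocks ts x (a : R) j0 :
  Ex muN (fun Omega : PS => bE (fun j => envs Omega (j0 + j)) ts x
    (fun s => sqpos (a + (bad_total v eps ts s - mean_bad ts)))) <=
  sqpos a + var_bad ts.
Proof.
elim: ts x a j0 => [|t ts IH] x a j0.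
  by rewrite /= /mean_bad /var_bad !big_nil subrr !addr0 Ex_cst.
pose a' s := a + (bad_length v eps t s - t%:R * p t).
pose H s (Omega : PS) := bE (fun j => envs Omega (j0.+1 + j)) ts (x + pos s)
  (fun s' => sqpos (a' s + (bad_total v eps ts s' - mean_bad ts))).
have bH s : bmf (H s) by exact: bmf_bE.
have wb s : bmf (fun omega : environment R => weight (fun=> env omega) x s).
  exact: bmf_weight.
have e Omega : bE (fun j => envs Omega (j0 + j)) (t :: ts) x
    (fun s => sqpos (a + (bad_total v eps (t :: ts) s - mean_bad (t :: ts)))) =
    \sum_(s <- walks t) weight (fun=> env (Omega j0)) x s * H s Omega.
  rewrite /= addn0 qE_sum big_seq [RHS]big_seq; apply: eq_bigr => s.
  rewrite mem_walks => /eqP hs; congr (_ * _).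
  rewrite /H (_ : (fun j => envs Omega (j0 + j.+1)) =
    (fun j => envs Omega (j0.+1 + j))); last first.
    by apply/funext => j; rewrite addSnnS.
  apply: eq_bE => s' _; rewrite /a' -[X in take X _]hs -[X in drop X _]hs.
  rewrite take_size_cat // drop_size_cat // /mean_bad big_cons.
  by congr sqpos; ring.
rewrite (_ : Ex muN _ = Ex muN (fun Omega : PS => \sum_(s <- walks t)
    weight (fun=> env (Omega j0)) x s * H s Omega)); last first.
  by congr Ex; apply/funext => Omega; rewrite e.
rewrite Ex_sum; last first.
  move=> s; apply: bmfM => //.
  apply: (bmf_comp (g := fun Omega : PS => Omega j0) _ (wb s)).
  exact: measurable_coord.
have step1 s : Ex muN (fun Omega : PS =>
    weight (fun=> env (Omega j0)) x s * H s Omega) <=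
    Ex mu (fun omega => weight (fun=> env omega) x s *
       (sqpos (a' s) + var_bad ts)).
  rewrite (Ex_indep HmuN (i := j0) (wb s) (bH s)); last first.
    move=> g om; rewrite /H; congr bE; apply/funext => j.
    by rewrite /envs /upd ifF //; lia.
  have -> : Ex mu (fun omega => weight (fun=> env omega) x s *
      (sqpos (a' s) + var_bad ts)) =
      Ex mu (fun omega : environment R => weight (fun=> env omega) x s) *
      (sqpos (a' s) + var_bad ts).
    rewrite mulrC -ExZ //; congr Ex; apply/funext => omega; exact: mulrC.
  apply: ler_wpM2l; last exact: IH.
  apply: Ex_ge0 => omega; apply: weight_ge0 => _ z.
  exact: (elliptic01 c0 (env_elliptic sigma phic omega)).
apply: (le_trans (ler_sum _ (fun s _ => step1 s))).
rewrite -Ex_sum; last by move=> s; apply: bmfM => //; exact: bmf_cst.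
have -> : (fun omega : environment R => \sum_(s <- walks t)
    weight (fun=> env omega) x s * (sqpos (a' s) + var_bad ts)) =
  (fun omega => qE (fun=> env omega) t x (fun s => sqpos (a' s)) + var_bad ts).
  apply/funext => omega; rewrite -qE_sum qED qE_cst //.
rewrite ExD; [|exact: (bmf_qE sigma mphi c0 phic)|exact: bmf_cst].
rewrite Ex_cst /var_bad big_cons addrA lerD2r.
exact: Ex_block_step.
Qed.

End AnnealedBlocks.

(** * The cooling map *)

Section CoolingBlocks.
Variable tau : cooling_map.
Implicit Types (n j k i L : nat).

Lemma cooling_le : {homo tau : m n / (m <= n)%N}.
Proof.
move=> m n; rewrite leq_eqVlt => /orP[/eqP -> //|h].
by rewrite ltnW // cooling_mono.
Qed.

Lemma cooling_ge n : (n <= tau n)%N.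
Proof.
elim: n => // n IH; apply: leq_ltn_trans IH _; exact: cooling_mono.
Qed.

Lemma ell_block j i : (tau j <= i < tau j.+1)%N -> ell tau i = j.+1.
Proof.
move=> /andP[h1 h2]; rewrite /ell; case: ex_minnP => m hm hmin.
apply/eqP; rewrite eqn_leq hmin // ltnNge; apply/negP => /cooling_le h3.
by have := leq_ltn_trans (leq_trans h3 h1) hm; rewrite ltnn.
Qed.

(* The blocks of time before n, the last ones possibly cut or empty. *)
Definition cut n j := minn (tau j) n.

Definition lens_from n j k : seq nat :=
  [seq (cut n i.+1 - cut n i)%N | i <- iota j k].

(** As tau n >= n, the first n blocks exhaust the time before n. *)
Definition lens n := lens_from n 0 n.

Lemma cutS n j : (cut n j <= cut n j.+1)%N.
Proof. by have := cooling_le (leqnSn j); rewrite /cut; lia. Qed.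

Lemma sumn_lens_from n j k : (cut n j + sumn (lens_from n j k) = cut n (j + k))%N.
Proof.
elim: k j => [|k IH] j; first by rewrite addn0 addn0.
by rewrite /lens_from /= -addSnnS -IH; have := cutS n j; rewrite /lens_from; lia.
Qed.

Lemma sumn_lens n : sumn (lens n) = n.
Proof.
have := sumn_lens_from n 0 n; rewrite /cut cooling0 min0n add0n => ->.
by apply/minn_idPr; exact: cooling_ge.
Qed.

Lemma agree_lens (R : realType) (u : nat -> int -> R) n :
  agree (fun i => u (ell tau i).-1) u (lens n).
Proof.
(* Generalised to the blocks from j on, with time counted from [cut n j]. *)
suff H k j : agree (fun i => u (ell tau (cut n j + i)).-1)
    (fun i => u (j + i)%N) (lens_from n j k).
  by have := H n 0%N; rewrite /cut cooling0 min0n.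
elim: k j => [|k IH] j //=; split.
  move=> i hi; rewrite addn0 (@ell_block j) //.
  by move: hi; rewrite /cut; lia.
have := IH j.+1; congr agree.
  apply/funext => i; congr (u (ell tau _).-1).
  by have := cutS n j; lia.
by apply/funext => i; rewrite addSnnS.
Qed.

(** Blocks before j0 have total length at most tau j0. Among the later ones only the block cut at n
    can be short without being empty. *)
Lemma short_blocks n L j0 k :
  (forall j, (j0 <= j)%N -> (L <= tau j.+1 - tau j)%N) ->
  (\sum_(t <- lens_from n 0 k | (t < L)%N) t <= tau j0 + L)%N.
Proof.
move=> HL.
(* The extra L is charged once, when block ends pass n; all further blocks are empty. *)
suff H : (\sum_(t <- lens_from n 0 k | (t < L)%N) t <=
    cut n (minn k j0) + (if (n < tau k)%N then L else 0%N))%N.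
  apply: (leq_trans H); apply: leq_add; last by case: ifP.
  by apply: leq_trans (geq_minl _ _) _; apply: cooling_le; exact: geq_minr.
elim: k => [|k IH]; first by rewrite /lens_from big_nil.
rewrite /lens_from -addn1 iotaD map_cat big_cat /= big_cons big_nil add0n addn1.
have hk := cooling_le (leqnSn k).
have [kj|kj] := ltnP k j0.
  rewrite (minn_idPl kj); rewrite (minn_idPl (ltnW kj)) in IH.
  have := cutS n k; move: IH; rewrite /lens_from.
  case: ifP; case: ifP; case: ifP => *; lia.
rewrite (minn_idPr (leqW kj)); rewrite (minn_idPr kj) in IH.
have := HL k kj; move: IH; rewrite /lens_from /cut.
case: ifP; case: ifP; case: ifP => *; lia.
Qed.

End CoolingBlocks.

(** * Annealed deviation bound for the cooling walk *)

Section CoolingRate.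
Context {R : realType}.
Variable tau : cooling_map.
Hypothesis Htau : (fun k : nat => (tau k.+1 - tau k)%N) @ \oo --> \oo.

(** Blocks of length at least L have p <= d / 2, and the shorter ones have bounded total length, at
    most d n / 2 for large n. *)
Lemma mean_bad_small (p : nat -> R) : (forall t, 0 <= p t <= 1) ->
  (forall d : R, 0 < d -> exists L : nat, forall t, (L <= t)%N -> p t <= d) ->
  forall d : R, 0 < d -> exists n0 : nat, forall n, (n0 <= n)%N ->
    mean_bad p (lens tau n) <= d * n%:R.
Proof.
move=> p01 p0 d d0.
have d20 : 0 < d / 2 by rewrite divr_gt0.
have [L HL] := p0 _ d20.
have /cvgnyPge /(_ L) [j0 _ Hj0] := Htau.
have [n0 hn0] := nat_upper ((tau j0 + L)%:R / (d / 2)).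
exists n0 => n hn.
have hS : (\sum_(t <- lens tau n | (t < L)%N) t <= tau j0 + L)%N.
  by apply: short_blocks => j; exact: Hj0.
apply: (@le_trans _ _ (d / 2 * (sumn (lens tau n))%:R +
   (\sum_(t <- lens tau n | (t < L)%N) t)%:R)).
  rewrite sumnE !natr_sum mulr_sumr [X in _ + X]big_mkcond -big_split /=.
  apply: ler_sum => t _; have /andP[q0 q1] := p01 t.
  case: (ltnP t L) => tL.
    rewrite (le_trans (_ : _ <= t%:R)) ?lerDr ?mulr_ge0 ?(ltW d0) //.
    by rewrite ler_piMr.
  by rewrite addr0 mulrC ler_wpM2r // HL.
rewrite sumn_lens.
have h1 : (\sum_(t <- lens tau n | (t < L)%N) t)%:R <= (tau j0 + L)%:R :> R.
  by rewrite ler_nat.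
have h2 : n0%:R <= n%:R :> R by rewrite ler_nat.
have h3 : (tau j0 + L)%:R <= d / 2 * n%:R.
  by rewrite -ler_pdivrMl // mulrC (le_trans hn0).
lra.
Qed.

(** Each t^2 p(t) is at most C t n^(1 - eta), and the lengths t sum to n. *)
Lemma var_bad_le (p : nat -> R) (C eta : R) n : 0 <= C -> 0 < eta <= 1 ->
  (0 < n)%N -> (forall t, (0 < t)%N -> p t <= C * t%:R `^ (- eta)) ->
  var_bad p (lens tau n) <= 2 * C * n%:R ^+ 2 * n%:R `^ (- eta).
Proof.
move=> C0 /andP[eta0 eta1] n0 hp.
have n_gt0 : 0 < n%:R :> R by rewrite ltr0n.
have sq (t : nat) : (0 < t)%N ->
    (t%:R ^+ 2 * t%:R `^ (- eta) = t%:R * t%:R `^ (1 - eta) :> R).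
  move=> t0; have t_gt0 : 0 < t%:R :> R by rewrite ltr0n.
  rewrite powRD; last by apply/implyP => _; exact: lt0r_neq0.
  by rewrite powRr1 ?ler0n // expr2 mulrA.
have -> : 2 * C * n%:R ^+ 2 * n%:R `^ (- eta) =
    \sum_(t <- lens tau n) t%:R * (2 * C * n%:R `^ (1 - eta)).
  rewrite -mulr_suml -natr_sum -sumnE sumn_lens -mulrA sq //; ring.
rewrite /var_bad big_seq [leRHS]big_seq; apply: ler_sum => t ht.
have [->|t0] := posnP t; first by rewrite !mul0r expr0n /= mul0r mulr0.
have tn : (t <= n)%N.
  by rewrite -[n in leqRHS](sumn_lens tau) sumnE (big_rem t ht) leq_addr.
have h : t%:R ^+ 2 * p t <= C * (t%:R * t%:R `^ (1 - eta)).
  by rewrite -sq // mulrCA ler_wpM2l ?sqr_ge0 // hp.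
have h2 : t%:R `^ (1 - eta) <= n%:R `^ (1 - eta) :> R.
  by rewrite ge0_ler_powR ?nnegrE ?subr_ge0 // ler_nat.
have h3 : C * (t%:R * t%:R `^ (1 - eta)) <= C * (t%:R * n%:R `^ (1 - eta)).
  by rewrite ler_wpM2l // ler_wpM2l.
lra.
Qed.

Lemma powR_small (C eta d : R) : 0 <= C -> 0 < eta -> 0 < d ->
  exists L : nat, forall t, (L <= t)%N -> C * t%:R `^ (- eta) <= d.
Proof.
move=> C0 eta0 d0.
have [L hL] := nat_upper ((C / d) `^ (eta^-1) + 1).
exists L => t Lt.
have t1 : (C / d) `^ (eta^-1) + 1 <= t%:R by rewrite (le_trans hL) // ler_nat.
have q0 : 0 <= (C / d) `^ (eta^-1) by exact: powR_ge0.
have t0 : 0 < t%:R :> R by lra.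
have h : C / d <= t%:R `^ eta.
  have -> : C / d = ((C / d) `^ eta^-1) `^ eta.
    by rewrite -powRrM mulVf ?lt0r_neq0 // powRr1 // divr_ge0 // ltW.
  by rewrite ge0_ler_powR ?nnegrE ?(ltW eta0) ?(ltW t0) //; lra.
rewrite powRN ler_pdivrMr ?powR_gt0 //.
by rewrite mulrC -ler_pdivrMr.
Qed.

Variables (mu : probability (environment R) R)
  (muN : probability (product_space nat (environment R)) R).
Hypothesis HmuN : is_product_law mu muN.
Variables (phi : R -> R) (c : R) (sigma : int -> int).
Hypothesis mphi : measurable_fun [set: measurableTypeR R] phi.
Hypothesis c0 : 0 < c.
Hypothesis phic : forall w, c <= phi w <= 1 - c.
Variable v : R.
Hypothesis Hv : forall eps : R, 0 < eps -> polydecay (fun n x =>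
  annealed mu phi sigma n x
    (fun s => (eps * n%:R <= `|(pos s)%:~R - v * n%:R|)%R%:R)).
Local Notation PS := (product_space nat (environment R)).

Lemma cooling_rate (eps : R) : 0 < eps ->
  exists2 C : R, 0 <= C & exists2 eta : R, 0 < eta <= 1 &
  exists n0, forall n, (n0 <= n)%N ->
    Ex muN (fun Omega : PS => bE (envs phi sigma Omega) (lens tau n) 0
      (fun s => (3 * eps * n%:R <= `|(pos s)%:~R - v * n%:R|)%R%:R))
    <= C * n%:R `^ (- eta).
Proof.
move=> e0; have [C C0 [eta heta H]] := Hv e0.
have /andP[eta0 eta1] := heta.
pose p t : R := Num.min 1 (C * t%:R `^ (- eta)).
have p01 t : 0 <= p t <= 1.
  by rewrite /p le_min ler01 ge_min lexx mulr_ge0 // powR_ge0.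
have u01 omega := elliptic01 c0 (env_elliptic sigma phic omega).
have pP t x : (0 < t)%N -> annealed mu phi sigma t x
    (fun s => (eps * t%:R <= `|(pos s)%:~R - v * t%:R|)%R%:R) <= p t.
  move=> t0; rewrite /p le_min H // andbT.
  rewrite -[leRHS](Ex_cst mu); apply: le_Ex.
  - exact: (bmf_qE sigma mphi c0 phic).
  - exact: bmf_cst.
  move=> omega; rewrite -[leRHS](qE_cst (fun=> env phi sigma omega) t x).
  apply: le_qE => [_ z|s _]; first exact: u01.
  by case: (eps * _ <= _).
(* A deviation of 3 eps n forces a bad length of at least 2 d n by [bad_total_dev]. Its centring m
   is at most d n, which leaves an excess of d n for Chebyshev's inequality. *)
pose d := eps / (1 + `|v|).
have v1 : 0 < 1 + `|v| by rewrite ltr_pwDl.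
have d0 : 0 < d by rewrite divr_gt0.
have [n0 hn0] : exists n0 : nat, forall n, (n0 <= n)%N ->
    mean_bad p (lens tau n) <= d * n%:R.
  apply: mean_bad_small => // d' d'0.
  have [L HL] := powR_small C0 eta0 d'0; exists L => t Lt.
  by rewrite /p ge_min HL // orbT.
exists (2 * C / d ^+ 2); first by rewrite divr_ge0 ?sqr_ge0 // mulr_ge0.
exists eta => //; exists n0.+1 => n hn.
have n_gt0 : 0 < n%:R :> R by rewrite ltr0n (leq_trans (ltn0Sn n0) hn).
have dn : 0 < d * n%:R by rewrite mulr_gt0.
pose m := mean_bad p (lens tau n).
have bb := bmf_bE sigma mphi c0 phic (lens tau n) 0 _ 0.
apply: (@le_trans _ _ (Ex muN (fun Omega : PS => ((d * n%:R) ^+ 2)^-1 *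
  bE (fun j => envs phi sigma Omega (0 + j)) (lens tau n) 0
   (fun s => sqpos (0 + (bad_total v eps (lens tau n) s - m)))))).
  apply: le_Ex; first exact: bb.
    by apply: bmfM; [exact: bmf_cst|exact: bb].
  move=> Omega; rewrite -bEZ; apply: le_bE => [|s]; first exact: (envs01 sigma c0 phic).
  rewrite sumn_lens => hs.
  have [hdev|_] := lerP (3 * eps * n%:R); last first.
    by rewrite mulr_ge0 ?invr_ge0 ?sqr_ge0.
  rewrite mulrC ler_pdivlMr ?exprn_gt0 // mul1r add0r.
  have := bad_total_dev v (ltW e0) (esym (etrans (sumn_lens tau n) (esym hs))).
  rewrite sumn_lens => h1.
  have h2 : 2 * (eps * n%:R) <= (1 + `|v|) * bad_total v eps (lens tau n) s by lra.
  have h3 : 2 * (d * n%:R) <= bad_total v eps (lens tau n) s.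
    rewrite -(ler_pM2l v1) (le_trans _ h2) // le_eqVlt; apply/orP; left; apply/eqP.
    by rewrite /d; field; rewrite gt_eqF.
  have h4 : m <= d * n%:R := hn0 n (ltnW hn).
  have h5 : d * n%:R <= bad_total v eps (lens tau n) s - m by lra.
  rewrite /sqpos (max_idPl _) ?(le_trans (ltW dn)) //.
  by rewrite lerXn2r ?nnegrE ?(ltW dn) ?(le_trans (ltW dn)).
rewrite ExZ //.
apply: (@le_trans _ _ (((d * n%:R) ^+ 2)^-1 * var_bad p (lens tau n))).
  rewrite ler_wpM2l ?invr_ge0 ?sqr_ge0 //.
  have := Ex_blocks HmuN mphi c0 phic p01 pP (lens tau n) 0 0 0.
  by rewrite /sqpos maxxx expr0n /= add0r.
rewrite mulrC ler_pdivrMr ?exprn_gt0 //.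
apply: (le_trans (@var_bad_le p C eta n C0 heta _ _)).
- exact: leq_trans (ltn0Sn n0) hn.
- by move=> t _; rewrite /p ge_min lexx orbT.
rewrite le_eqVlt; apply/orP; left; apply/eqP.
by field; rewrite gt_eqF.
Qed.

End CoolingRate.

(** * Quenched laws *)

Section QuenchedLaw.
Context {R : realType}.
Variables (Omega : nat -> int -> R) (tau : cooling_map)
  (Q : probability path_space R).
Hypothesis Omega01 : forall i z, 0 <= Omega i z <= 1.
Hypothesis HQ : is_quenched_law Omega tau Q.
Implicit Types (s : seq bool) (n : nat).

Local Notation w := (fun i => Omega (ell tau i).-1).

Definition traj s (i : nat) : int := pos (take i s).

Lemma measurable_history n x : measurable (history n x).
Proof.
rewrite (_ : history n x = box (iota 0 n.+1) (fun i => [set x i])).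
  by apply: measurable_box => i _.
apply/seteqP; split => X H i; last first.
  by move=> hi; apply: H; rewrite mem_iota.
by rewrite mem_iota add0n ltnS => /andP[_ hi]; exact: H.
Qed.

Lemma measurable_path n (b : int -> bool) :
  measurable ([set X | b (X n)] : set path_space).
Proof.
have := @measurable_coord nat _ int n measurableT [set z | b z] I.
by rewrite setTI.
Qed.

Lemma weight_rcons (u : nat -> int -> R) x s b :
  weight u x (rcons s b) = weight u x s * jump (u (size s) (x + pos s)) b.
Proof.
elim: s u x => [|a s IH] u x /=.
  by rewrite pos_nil addr0 mulr1 mul1r.
by rewrite IH pos_cons addrA mulrA.
Qed.

Lemma history_rcons s b : history (size s).+1 (traj (rcons s b)) =
  [set X | X (size s).+1 = traj s (size s) + step b] `&`
  history (size s) (traj s).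
Proof.
have e i : (i <= size s)%N -> traj (rcons s b) i = traj s i.
  by move=> hi; rewrite /traj -cats1 takel_cat.
have e' : traj (rcons s b) (size s).+1 = traj s (size s) + step b.
  rewrite /traj take_oversize ?size_rcons // take_size -cats1 pos_cat.
  by rewrite pos_cons pos_nil addr0.
apply/seteqP; split => [X H|X [H1 H2] i] /=.
  split; first by rewrite H // e'.
  by move=> i hi; rewrite H ?e // leqW.
rewrite leq_eqVlt ltnS => /orP[/eqP ->|hi]; first by rewrite e'.
by rewrite e // H2.
Qed.

(** Chain rule, by induction on the last step. *)
Lemma history_weight s :
  Q (history (size s) (traj s)) = (weight w 0 s)%:E.
Proof.
have [Q0 Q1] := HQ.
elim/last_ind: s => [|s b IH].
  rewrite /= -Q0; congr (Q _); apply/seteqP; split => [X H|X H i].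
    by have := H 0%N (leqnn 0); rewrite /traj pos_nil.
  by rewrite /= leqn0 => /eqP ->; rewrite /traj pos_nil.
rewrite size_rcons history_rcons weight_rcons add0r.
set A := [set X | _]; set B := history _ _ in IH *.
have mB : measurable B by exact: measurable_history.
have mA : measurable (A : set path_space).
  have := measurable_path (size s).+1
    (fun z => z == traj s (size s) + step b).
  congr measurable; apply/seteqP; split => X /=; [by move/eqP|].
  by move=> ->.
have W0 : 0 <= weight w 0 s by apply: weight_ge0.
(* Nothing is prescribed after a null history, but then both sides are 0. *)
move: W0; rewrite le_eqVlt => /orP[/eqP W0|W0].
  rewrite -W0 mul0r; apply/eqP; rewrite -measure_le0.
  have -> : 0%E = Q B :> \bar R by rewrite IH -W0.
  apply: le_measure; rewrite ?inE; [exact: measurableI|exact: mB|exact: subIsetr].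
have QB : (0 < Q B)%E by rewrite IH lte_fin.
have [h1 h2] := Q1 (size s) (traj s) QB.
have -> : Q (A `&` B) = (fine (Q (A `&` B)))%:E.
  by rewrite fineK // fin_num_measure //; exact: measurableI.
congr EFin.
have fB : fine (Q B) = weight w 0 s by rewrite IH.
have key r : cond_pr Q A B = r -> fine (Q (A `&` B)) = weight w 0 s * r.
  move=> <-; rewrite /cond_pr fB mulrC divfK // gt_eqF //.
apply: key; rewrite /A /B.
have et : traj s (size s) = pos s by rewrite /traj take_size.
by rewrite -et; case: b {A mA} => //=.
Qed.

Definition walk_event n : set path_space :=
  [set X | exists2 s, size s = n & history n (traj s) X].

Lemma negligible_seq (J : eqType) (l : seq J) (F : J -> set path_space) :
  (forall j, j \in l -> Q.-negligible (F j)) ->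
  Q.-negligible [set X | exists2 j, j \in l & F j X].
Proof.
elim: l => [|j l IH] H.
  rewrite (_ : [set X | _] = set0); first exact: negligible_set0.
  by apply/seteqP; split => X // [].
rewrite (_ : [set X | _] = F j `|` [set X | exists2 j, j \in l & F j X]).
  apply: negligibleU; first by apply: H; rewrite inE eqxx.
  by apply: IH => i il; apply: H; rewrite inE il orbT.
apply/seteqP; split => X /=.
  move=> [i]; rewrite inE => /orP[/eqP ->|il] h; first by left.
  by right; exists i.
move=> [h|[i il h]]; first by exists j; rewrite ?inE ?eqxx.
by exists i; rewrite ?inE ?il ?orbT.
Qed.

(** Path space contains all integer sequences. The two continuations of a walk share its whole mass,
    as p + (1 - p) = 1, so each further step loses only a null set. *)
Lemma walk_event_ae n : Q.-negligible (~` walk_event n).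
Proof.
have [Q0 Q1] := HQ.
elim: n => [|n IH].
  exists (~` [set X | X 0%N = 0]); split.
  - apply: measurableC; have := measurable_path 0 (fun z => z == 0).
    by congr measurable; apply/seteqP; split => X /= /eqP.
  - have m0 : measurable ([set X | X 0%N = 0] : set path_space).
      have := measurable_path 0 (fun z => z == 0).
      by congr measurable; apply/seteqP; split => X /= /eqP.
    by apply: (etrans (probability_setC Q m0)); rewrite Q0 subee.
  - move=> X /= H X0; apply: H; exists [::] => // i.
    by rewrite leqn0 => /eqP ->; rewrite /traj pos_nil.
pose H s := history n (traj s).
pose H' s b := history n.+1 (traj (rcons s b)).
pose F s := H s `\` (H' s true `|` H' s false).
have nF s : s \in walks n -> Q.-negligible (F s).
  rewrite mem_walks => /eqP hs.
  have mH : measurable (H s) by exact: measurable_history.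
  have mH' b : measurable (H' s b) by exact: measurable_history.
  have mU : measurable (H' s true `|` H' s false) by exact: measurableU.
  have sub b : H' s b `<=` H s.
    by rewrite /H' /H -hs history_rcons; exact: subIsetr.
  apply/negligibleP; first exact: measurableD.
  have dis : H' s true `&` H' s false = set0.
    apply/seteqP; split => X // []; rewrite /H' -hs !history_rcons.
    move=> [/= -> _] [/= + _]; rewrite /step => /addrI h.
    by have : (1 : int) = -1 by []; lia.
  have QH' b : Q (H' s b) = (weight w 0 (rcons s b))%:E.
    by rewrite -history_weight size_rcons hs.
  have QH : Q (H s) = (weight w 0 s)%:E by rewrite -history_weight hs.
  rewrite measureD //; last by rewrite -ge0_fin_numE // fin_num_measure.
  rewrite (_ : H s `&` _ = H' s true `|` H' s false); last first.
    by apply/setIidPr => X [] /sub.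
  rewrite measureU //.
  rewrite [X in (X - _)%E]QH [X in (_ - (X + _))%E]QH' [X in (_ - (_ + X))%E]QH'.
  rewrite !weight_rcons -EFinD; apply: (etrans (esym (EFinB _ _))).
  by congr EFin; rewrite /jump; ring.
have [N [mN N0 sN]] := negligibleU IH (negligible_seq nF).
exists N; split => // X XH; apply: sN.
have [[s hs hX]|h] := pselect (walk_event n X); last by left.
right; exists s; first by rewrite mem_walks hs.
split => // -[] h; apply: XH.
  by exists (rcons s true); rewrite ?size_rcons ?hs.
by exists (rcons s false); rewrite ?size_rcons ?hs.
Qed.

Lemma quenched_prob_le n (b : int -> bool) :
  (Q [set X : nat -> int | b (X n)] <=
   (qE w n 0 (fun s => (b (pos s))%:R))%:E)%E.
Proof.
have [N [mN N0 sN]] := walk_event_ae n.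
pose H s := history n (traj s).
(* D is the union of the histories of those walks in l whose endpoint satisfies b; subadditivity
   bounds its mass. *)
have key (l : seq (seq bool)) : (forall s, s \in l -> size s = n) ->
   exists D : set path_space, [/\ measurable D,
     forall s X, s \in l -> H s X -> b (X n) -> D X &
     (Q D <= (\sum_(s <- l) weight w 0 s * (b (pos s))%:R)%:E)%E].
  elim: l => [|s l IH] hl.
    by exists set0; split => //; rewrite measure0 big_nil.
  have [|D [mD hD QD]] := IH.
    by move=> t tl; apply: hl; rewrite inE tl orbT.
  have hs : size s = n by apply: hl; rewrite inE eqxx.
  pose E : set path_space := if b (pos s) then H s else set0.
  have mE : measurable E by rewrite /E; case: ifP => // _; exact: measurable_history.
  exists (E `|` D); split; first exact: measurableU.
    move=> t X; rewrite inE => /orP[/eqP ->|tl] hX bX; last by right; exact: hD hX bX.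
    left; rewrite /E; have := hX n (leqnn n).
    by rewrite /traj -hs take_size => <-; rewrite hs bX.
  apply: (le_trans (measureU2 _ mE mD)); rewrite big_cons EFinD leeD //.
  rewrite /E; case: ifP => _; last by rewrite measure0 mulr0.
  by rewrite mulr1 -history_weight hs.
have [|D [mD hD QD]] := key (walks n).
  by move=> s; rewrite mem_walks => /eqP.
rewrite qE_sum; apply: le_trans QD.
apply: (@le_trans _ _ (Q (D `|` N))).
  apply: le_measure; rewrite ?inE; [exact: measurable_path|exact: measurableU|].
  move=> X /= bX; have [[s hs hX]|h] := pselect (walk_event n X).
    by left; apply: hD hX bX; rewrite mem_walks hs.
  by right; apply: sN.
apply: (le_trans (measureU2 _ mD mN)).
by rewrite [X in (_ + X)%E](_ : _ = 0%E) ?adde0.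
Qed.

Lemma nearest_neighbour_ae : {ae Q, forall X : nat -> int,
  forall m n, (m <= n)%N -> `|X n - X m| <= (n - m)%N%:Z}.
Proof.
have [N [mN N0 sN]] := ae_foralln walk_event_ae.
exists N; split => //; apply: subset_trans sN; apply: subsetC => X H m n mn.
have [s hs hX] := H n.
rewrite hX // hX // /traj -{1}(subnKC mn) takeD pos_cat addrAC subrr add0r.
apply: le_trans (pos_bound _) _; rewrite size_take size_drop hs.
by case: ifP => // *; lia.
Qed.

End QuenchedLaw.

(** * The strong law *)

Lemma bE_ge0 (R : realType) (u : nat -> int -> R) ts x F :
  (forall i z, 0 <= u i z <= 1) -> (forall s, 0 <= F s) -> 0 <= bE u ts x F.
Proof.
move=> u01 F0.
have <- : bE u ts x (fun=> 0) = 0.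
  elim: ts u x {u01} => [|t ts IH] u x //=.
  by under eq_qE do rewrite IH; exact: qE_cst.
exact: le_bE.
Qed.

(** * Summability and almost sure finiteness *)

Section Summability.
Context {R : realType}.

Lemma inv_square_series (a : nat -> R) (C : R) :
  (forall i, 0 <= a i) -> (forall i, a i <= C / i.+1%:R ^+ 2) ->
  (\sum_(0 <= i <oo) (a i)%:E < +oo)%E.
Proof.
move=> a0 aC.
have C0 : 0 <= C by have := le_trans (a0 0%N) (aC 0%N); rewrite expr1n divr1.
(* Telescoping: 1 / y^2 <= 2 (1 / y - 1 / (y + 1)) for y >= 1. *)
have partial n : \sum_(0 <= i < n) a i <= 2 * C * (1 - n.+1%:R^-1).
  elim: n => [|n IH]; first by rewrite big_nil invr1 subrr mulr0.
  rewrite big_nat_recr //=; apply: (le_trans (lerD IH (aC n))).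
  have n0 : 0 < n.+1%:R :> R by rewrite ltr0n.
  have e : n.+2%:R = n.+1%:R + 1 :> R by rewrite natr1.
  rewrite e; move: n0 => /=; set y := n.+1%:R => n0.
  have y1 : 1 <= y by rewrite /y ler1n.
  rewrite -subr_ge0.
  rewrite (_ : _ - _ = C * (y - 1) / (y ^+ 2 * (y + 1))).
    by rewrite divr_ge0 ?mulr_ge0 ?subr_ge0 ?sqr_ge0 // addr_ge0 // ltW.
  by field; rewrite !gt_eqF // addr_gt0.
apply: (@le_lt_trans _ _ (2 * C)%:E); last exact: ltry.
apply: lime_le; first by apply: is_cvg_nneseries => n _ _; rewrite lee_fin.
apply: nearW => n; rewrite sumEFin lee_fin (le_trans (partial n)) //.
by rewrite ler_piMr ?mulr_ge0 // gerBl.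
Qed.

(** By Tonelli's theorem the sum of the f i is integrable, hence almost everywhere finite. *)
Lemma ae_summable d (T : measurableType d) (P : probability T R)
    (f : nat -> T -> R) :
  (forall i, bmf (f i)) -> (forall i x, 0 <= f i x) ->
  (\sum_(0 <= i <oo) (Ex P (f i))%:E < +oo)%E ->
  {ae P, forall x, (\sum_(0 <= i <oo) (f i x)%:E < +oo)%E}.
Proof.
move=> bf f0 H.
pose g x := (\sum_(0 <= i <oo) (f i x)%:E)%E.
have mf i : measurable_fun setT (fun x => (f i x)%:E).
  by apply/measurable_EFinP; case: (bf i).
have f0' i x : setT x -> (0 <= (f i x)%:E)%E by rewrite lee_fin.
have gint : P.-integrable setT g.
  apply/integrableP; split.
    by apply: ge0_emeasurable_sum => // k x _ _; rewrite lee_fin.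
  have g0 x : (0 <= g x)%E by apply: nneseries_ge0 => i _ _; rewrite lee_fin.
  under eq_integral => x _ do rewrite gee0_abs //.
  rewrite integral_nneseries //.
  rewrite (eq_eseriesr (g := fun i => (Ex P (f i))%:E)) //.
  by move=> i _; rewrite EFin_Ex.
have [N [mN N0 sN]] := integrable_ae measurableT gint.
exists N; split => //; apply: subset_trans sN; apply: subsetC => x H' /=.
have := H' I; rewrite ge0_fin_numE //.
by apply: nneseries_ge0 => i _ _; rewrite lee_fin.
Qed.

End Summability.

(** * From the times i^A to all times *)

Section Interpolation.
Context {R : realType}.

Lemma bernoulli_le (x : R) A : 0 <= x <= 1 -> 1 - A%:R * x <= (1 - x) ^+ A.
Proof.
move=> /andP[x0 x1]; elim: A => [|A IH]; first by rewrite mul0r subr0 expr0.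
rewrite exprS -natr1; have h : 0 <= 1 - x by rewrite subr_ge0.
have := ler_wpM2l h IH.
have : 0 <= A%:R * x ^+ 2 by rewrite mulr_ge0 // sqr_ge0.
nra.
Qed.

(** Bernoulli's inequality at x = 1 / (m + 1). *)
Lemma power_gap A m : (m.+1 ^ A)%:R - (m ^ A)%:R <=
  A%:R / m.+1%:R * (m.+1 ^ A)%:R :> R.
Proof.
have m0 : 0 < m.+1%:R :> R by rewrite ltr0n.
have x01 : 0 <= (m.+1%:R^-1 : R) <= 1.
  by rewrite invr_ge0 ltW //= invf_le1 // ler1n.
have := bernoulli_le A x01.
have -> : 1 - m.+1%:R^-1 = m%:R / m.+1%:R :> R.
  by rewrite -natr1; field; rewrite natr1 gt_eqF.
rewrite expr_div_n ler_pdivlMr ?exprn_gt0 // -!natrX.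
by rewrite mulrBl mul1r !lerBlDr addrC.
Qed.

Lemma root_bracket A n : (0 < A)%N -> exists m, (m ^ A <= n < m.+1 ^ A)%N.
Proof.
move=> A0.
have ex : exists m, (m ^ A <= n)%N by exists 0%N; rewrite exp0n.
have ub m : (m ^ A <= n)%N -> (m <= n)%N.
  by apply: leq_trans; case: m => // m; rewrite -[leqLHS]expn1 leq_pexp2l.
have [m hm hmax] := ex_maxnP ex ub.
exists m; rewrite hm ltnNge; apply/negP => /hmax; by rewrite ltnn.
Qed.

Lemma interpolation (X : nat -> int) (v e : R) A k0 i0 : 0 < e -> (0 < A)%N ->
  (forall m n, (m <= n)%N -> `|X n - X m| <= (n - m)%N%:Z) ->
  (forall i, (i0 <= i)%N ->
    `|(X ((i + k0) ^ A)%N)%:~R - v * ((i + k0) ^ A)%:R| <= e * ((i + k0) ^ A)%:R) ->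
  exists n0, forall n, (n0 <= n)%N -> `|(X n)%:~R - v * n%:R| <= 2 * e * n%:R.
Proof.
move=> e0 A0 nn H.
pose cv := 1 + `|v|.
have cv0 : 0 < cv by rewrite ltr_pwDl.
(* With p = m^A and q = (m + 1)^A: m >= m2 gives q <= 2 p, and then m >= m1 gives (1 + |v|) (q - p)
   <= e p, which covers both the displacement and the drift between p and n. *)
have [m1 hm1] := nat_upper (2 * A%:R * cv / e).
have [m2 hm2] := nat_upper (2 * A%:R : R).
pose M := maxn (maxn m1 m2) (i0 + k0).
exists (M ^ A)%N => n hn.
have [m /andP[h1 h2]] := root_bracket n A0.
have Mm : (M <= m)%N.
  by rewrite -ltnS -(ltn_exp2r _ _ A0); exact: leq_ltn_trans hn h2.
have m1m : m1%:R <= m%:R :> R by rewrite ler_nat (leq_trans _ Mm) // /M; lia.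
have m2m : m2%:R <= m%:R :> R by rewrite ler_nat (leq_trans _ Mm) // /M; lia.
have hm : (i0 + k0 <= m)%N by rewrite (leq_trans _ Mm) // /M; lia.
have := H (m - k0)%N ltac:(lia); rewrite subnK; last lia.
have := power_gap A m; move: (m ^ A)%N (m.+1 ^ A)%N h1 h2 => p q h1 h2 gap.
have S0 : 0 < m.+1%:R :> R by rewrite ltr0n.
have S1 : m.+1%:R = m%:R + 1 :> R by rewrite natr1.
have p0 : 0 <= p%:R :> R by [].
have q0 : 0 <= q%:R :> R by [].
have half : A%:R / m.+1%:R * q%:R <= q%:R / 2 :> R.
  rewrite mulrC ler_wpM2l // ler_pdivrMr //; lra.
have q2 : q%:R <= 2 * p%:R :> R by have := le_trans gap half; lra.
have gap2 : cv * (q%:R - p%:R) <= e * p%:R.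
  apply: (@le_trans _ _ (cv * (A%:R / m.+1%:R * (2 * p%:R)))).
    rewrite ler_wpM2l ?(ltW cv0) // (le_trans gap) // ler_wpM2l // divr_ge0 //.
  rewrite (_ : cv * _ = (2 * A%:R * cv / m.+1%:R) * p%:R); last first.
    by field; rewrite gt_eqF.
  have k1 : 2 * A%:R * cv <= m1%:R * e by rewrite -ler_pdivrMr.
  rewrite ler_wpM2r // ler_pdivrMr // (le_trans k1) // mulrC.
  by rewrite ler_wpM2l ?(ltW e0) // S1 (le_trans m1m) // lerDl.
have pn : p%:R <= n%:R :> R by rewrite ler_nat.
have nq : n%:R <= q%:R :> R by rewrite ler_nat ltnW.
have hX : `|(X n)%:~R - (X p)%:~R| <= n%:R - p%:R :> R.
  rewrite -intrB -intr_norm -natrB //.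
  by have := nn p n h1; rewrite -(ler_int R).
move=> hp.
rewrite (_ : _ - _ = ((X p)%:~R - v * p%:R) + ((X n)%:~R - (X p)%:~R) -
   v * (n%:R - p%:R)); last by ring.
apply: (le_trans (ler_normB _ _)).
apply: (le_trans (lerD (ler_normD _ _) (lexx _))).
rewrite normrM [`|n%:R - p%:R|]ger0_norm ?subr_ge0 //.
have : (1 + `|v|) * (n%:R - p%:R) <= cv * (q%:R - p%:R).
  by rewrite ler_wpM2l ?(ltW cv0) // lerD2r.
have : e * p%:R <= e * n%:R by rewrite ler_wpM2l // ltW.
lra.
Qed.

End Interpolation.

(** * Almost sure convergence *)

Section StrongLaw.
Context {R : realType}.
Variables (alpha : probability (measurableTypeR R) R)
  (mu : probability (environment R) R)
  (muN : probability (product_space nat (environment R)) R)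
  (tau : cooling_map).
Hypothesis Hmu : is_product_law alpha mu.
Hypothesis HmuN : is_product_law mu muN.
Hypothesis Htau : (fun k : nat => (tau k.+1 - tau k)%N) @ \oo --> \oo.
Variable c : R.
Hypothesis c0 : 0 < c.
Hypothesis c12 : c <= 1 - c.
Hypothesis Hc : alpha.-negligible (~` [set w : R | c <= w <= 1 - c]).
Local Notation PS := (product_space nat (environment R)).
Local Notation v := (speed alpha).

Lemma sites_elliptic_ae : {ae muN, forall Omega : PS,
  forall j y, c <= Omega j y <= 1 - c}.
Proof.
pose I : set (measurableTypeR R) := [set w : R | c <= w <= 1 - c].
have mI : measurable I.
  rewrite (_ : I = `[c, 1 - c]%classic); first exact: measurable_itv.
  by apply/seteqP; split => w /=; rewrite in_itv.
have site j y : {ae muN, forall Omega : PS, c <= Omega j y <= 1 - c}.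
  pose E : set (environment R) := [set omega | c <= omega y <= 1 - c].
  have mE : measurable E.
    by have := measurable_coord y measurableT mI; rewrite setTI.
  have muE : mu (~` E) = 0%E.
    have := Hmu (s := [:: y]) (A := fun=> ~` I) isT (fun _ _ => measurableC mI).
    rewrite big_seq1 (measure_negligible (measurableC mI) Hc) /= => h.
    apply: etrans h; congr (mu _); apply/seteqP; split => omega /= h.
      by move=> i; rewrite inE => /eqP ->.
    by apply: h; rewrite inE.
  exists [set Omega | (~` E) (Omega j)]; split => //.
    have := measurable_coord j measurableT (measurableC mE).
    by rewrite setTI.
  have := HmuN (s := [:: j]) (A := fun=> ~` E) isT (fun _ _ => measurableC mE).
  rewrite big_seq1 muE /= => h.
  apply: etrans h; congr (muN _); apply/seteqP; split => omega /= h.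
    by move=> i; rewrite inE => /eqP ->.
  by apply: h; rewrite inE.
(* Sites are enumerated separately on the nonnegative and the negative half-line. *)
have [N [mN N0 sN]] := ae_foralln (fun j => ae_foralln (fun k => site j k%:Z)).
have [N' [mN' N0' sN']] :=
  ae_foralln (fun j => ae_foralln (fun k => site j (Negz k))).
have [K [mK K0 sK]] : muN.-negligible (N `|` N').
  by apply: negligibleU; [exists N; split|exists N'; split].
exists K; split => // Omega bad; apply: sK.
have [hN|hN] := pselect (N Omega); first by left.
right; apply: sN' => h'; apply: bad => j [k|k]; last exact: h'.
by apply: contrapT => hk; apply: hN; apply: sN => h; apply: hk.
Qed.

Definition deviates (eps : R) n (z : int) : bool :=
  3 * eps * n%:R <= `|z%:~R - v * n%:R|.

Lemma sparse_summable (eps : R) : 0 < eps ->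
  exists A k0, (0 < A)%N /\ {ae muN, forall Omega : PS,
    (\sum_(0 <= i <oo) (bE (envs (clip c) id Omega)
      (lens tau ((i + k0) ^ A)) 0
      (fun s => (deviates eps ((i + k0) ^ A) (pos s))%:R))%:E < +oo)%E}.
Proof.
move=> e0; have m1 := @measurable_clip R c; have e1 := clip_itv c12.
have [C C0 [eta /andP[eta0 eta1] [n0 hn0]]] :=
  cooling_rate Htau HmuN m1 c0 e1 (static_rate Hmu c0 c12 Hc) e0.
have [A0 hA0] := nat_upper (2 / eta).
(* A eta >= 2 makes the bound summable along the times (i + k0)^A; the shift k0 puts all of them
   beyond n0. *)
pose A := maxn A0 1; pose k0 := n0.+1.
have A_gt0 : (0 < A)%N by rewrite /A leq_max orbT.
have hA : 2 <= A%:R * eta.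
  by rewrite -ler_pdivrMr // (le_trans hA0) // ler_nat /A leq_maxl.
exists A, k0; split => //; apply: ae_summable.
- by move=> i; exact: (bmf_bE id m1 c0 e1 _ 0 _ 0).
- by move=> i Omega; apply: bE_ge0 => //; exact: (envs01 id c0 e1).
apply: (@inv_square_series _ _ C) => i.
  by apply: Ex_ge0 => Omega; apply: bE_ge0 => //; exact: (envs01 id c0 e1).
have big : (n0 <= (i + k0) ^ A)%N.
  apply: (@leq_trans (i + k0)); first by rewrite /k0 addnS leqW // leq_addl.
  by rewrite -[leqLHS]expn1 leq_pexp2l // /k0 addnS.
apply: (le_trans (hn0 _ big)); rewrite ler_wpM2l //.
have i0 : 0 < i.+1%:R :> R by rewrite ltr0n.
have ik : i.+1%:R <= (i + k0)%:R :> R by rewrite ler_nat /k0 addnS ltnS leq_addr.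
have ik1 : 1 <= (i + k0)%:R :> R by rewrite ler1n /k0 addnS.
rewrite natrX -powR_mulrn // -powRrM mulrN powRN lef_pV2 ?posrE ?exprn_gt0 //; last first.
  by rewrite powR_gt0 // (lt_le_trans i0).
apply: (@le_trans _ _ ((i + k0)%:R ^+ 2)); first by rewrite lerXn2r ?nnegrE.
by rewrite -powR_mulrn // ler_powR.
Qed.

(** Borel-Cantelli under Q for a fixed Omega. The bounds on the events F i depend on Omega alone, so
    one null set of environments serves every quenched law Q. *)
Lemma deviation_ae (eps : R) : 0 < eps ->
  {ae muN, forall Omega : PS, forall Q : probability path_space R,
    is_quenched_law Omega tau Q ->
    {ae Q, forall X : nat -> int, exists n0, forall n, (n0 <= n)%N ->
      `|(X n)%:~R - v * n%:R| <= 6 * eps * n%:R}}.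
Proof.
move=> e0; have e1 := clip_itv c12.
have [A [k0 [A0 [N [mN N0 sN]]]]] := sparse_summable e0.
have [N' [mN' N0' sN']] := sites_elliptic_ae.
have [K [mK K0 sK]] : muN.-negligible (N `|` N').
  by apply: negligibleU; [exists N; split|exists N'; split].
exists K; split => // Omega bad; apply: sK.
have [hN|hN] := pselect (N Omega); first by left.
right; apply: sN' => hell; apply: bad => Q HQ.
have hsum : (\sum_(0 <= i <oo) (bE (envs (clip c) id Omega)
      (lens tau ((i + k0) ^ A)) 0
      (fun s => (deviates eps ((i + k0) ^ A) (pos s))%:R))%:E < +oo)%E.
  by apply: contrapT => h; apply: hN; apply: sN => h'; apply: h.
(* On elliptic environments clipping changes nothing, so the summability concerns the actual
   walk. *)
have envE : envs (clip c) id Omega = Omega :> (nat -> int -> R).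
  by apply/funext => j; apply/funext => y; exact: clip_id.
rewrite {}envE in hsum.
have O01 i z : 0 <= Omega i z <= 1.
  have /andP[h1 h2] := hell i z.
  by rewrite (le_trans (ltW c0) h1) (le_trans h2) // gerBl ltW.
pose F i : set path_space := [set X | deviates eps ((i + k0) ^ A) (X ((i + k0) ^ A)%N)].
have mF i : measurable (F i) by exact: measurable_path.
have QF i : (Q (F i) <= (bE Omega (lens tau ((i + k0) ^ A)) 0
      (fun s => (deviates eps ((i + k0) ^ A) (pos s))%:R))%:E)%E.
  rewrite -(qE_bE _ _ (agree_lens tau Omega ((i + k0) ^ A))) sumn_lens.
  exact: quenched_prob_le.
have lim0 : Q (lim_sup_set F) = 0%E.
  apply: lim_sup_set_cvg0 => //; apply: le_lt_trans hsum.
  by apply: lee_nneseries => *; [exact: measure_ge0|exact: QF].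
have [M [mM M0 sM]] := nearest_neighbour_ae O01 HQ.
have mL : measurable (lim_sup_set F).
  by apply: bigcap_measurable => // n _; apply: bigcup_measurable => i _.
have [L [mL' L0 sL]] : Q.-negligible (M `|` lim_sup_set F).
  by apply: negligibleU; [exists M; split|apply/negligibleP].
exists L; split => // X badX; apply: sL.
have [hM|hM] := pselect (M X); first by left.
right; apply: contrapT => hlim; apply: badX.
have nn m n : (m <= n)%N -> `|X n - X m| <= (n - m)%N%:Z.
  by apply: contrapT => h; apply: hM; apply: sM => h'; apply: h; exact: h'.
have [i0 hi0] : exists i0, forall i, (i0 <= i)%N -> ~ F i X.
  apply: contrapT => h; apply: hlim => n _; apply: contrapT => h'.
  by apply: h; exists n => i ni Fi; apply: h'; exists i.
(* Interpolation doubles the error 3 eps, whence 6 eps. *)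
have e3 : 0 < 3 * eps by rewrite mulr_gt0.
have [n0 hn0] := @interpolation R X v (3 * eps) A k0 i0 e3 A0 nn
  (fun i hi => ltac:(by have := hi0 i hi; rewrite /F /deviates /=;
     move/negP; rewrite -ltNge => /ltW)).
exists n0 => n hn; apply: (le_trans (hn0 n hn)).
by rewrite mulrA -natrM.
Qed.

(** The values eps = 1 / (k + 1) suffice, and countably many null sets have a null union. *)
Lemma strong_law : {ae muN, forall Omega : PS,
  forall Q : probability path_space R,
    is_quenched_law Omega tau Q ->
    {ae Q, forall X : nat -> int,
      (fun n : nat => (X n)%:~R / n%:R : R) @ \oo --> v}}.
Proof.
have k_gt0 k : 0 < (k.+1%:R^-1 : R) by rewrite invr_gt0.
have [N [mN N0 sN]] := ae_foralln (fun k => deviation_ae (k_gt0 k)).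
exists N; split => // Omega bad; apply: sN => H; apply: bad => Q HQ.
have [M [mM M0 sM]] := ae_foralln (fun k => H k Q HQ).
exists M; split => // X badX; apply: sM => HX; apply: badX.
apply/cvgrPdist_le => e e0.
have [k hk] := nat_upper (6 / e).
have [n0 hn0] := HX k.
exists (maxn n0 1) => // n /= hn.
have n_gt0 : 0 < n%:R :> R by rewrite ltr0n (leq_trans (leq_maxr _ _) hn).
have h := hn0 n (leq_trans (leq_maxl _ _) hn).
have -> : v - (X n)%:~R / n%:R = - (((X n)%:~R - v * n%:R) / n%:R).
  by field; rewrite gt_eqF.
rewrite normrN normrM normfV [`|n%:R|]ger0_norm ?(ltW n_gt0) // ler_pdivrMr //.
rewrite (le_trans h) // ler_wpM2r ?(ltW n_gt0) //.
rewrite ler_pdivrMr // mulrC -ler_pdivrMr // (le_trans hk) // ler_nat.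
exact: leqnSn.
Qed.

End StrongLaw.

Theorem theorem1 (R : realType)
    (alpha : probability (measurableTypeR R) R)
    (mu : probability (environment R) R)
    (muN : probability (product_space nat (environment R)) R)
    (tau : cooling_map) :
  alpha [set w : R | 0 < w < 1] = 1%E ->
  is_product_law alpha mu ->
  is_product_law mu muN ->
  basic alpha ->
  (fun k : nat => (tau k.+1 - tau k)%N) @ \oo --> \oo ->
  {ae muN, forall Omega : nat -> int -> R,
    forall Q : probability path_space R,
      is_quenched_law Omega tau Q ->
      {ae Q, forall X : nat -> int,
        (fun n : nat => (X n)%:~R / n%:R : R) @ \oo --> speed alpha}}.
Proof.
move=> _ Hmu HmuN [[c [c0 Hc]] _] Htau.
have Hn : alpha.-negligible (~` [set w : R | c <= w <= 1 - c]).
  have [N [mN N0 sN]] := negligible_outside_support alpha.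
  exists N; split => //; apply: subset_trans sN; apply: subsetC => w /Hc /=.
  by rewrite in_itv.
(* Otherwise [c, 1 - c] is empty and the whole space would be null. *)
have c12 : c <= 1 - c.
  rewrite leNgt; apply/negP => hlt.
  have [N [mN N0 sN]] := Hn.
  have NT : N = setT.
    apply/seteqP; split => // w _; apply: sN => /= /andP[h1 h2].
    by have := lt_le_trans hlt h1; rewrite ltNge h2.
  move: N0; rewrite NT => /(etrans (esym (probability_setT alpha))) /eqP.
  by rewrite onee_eq0.
exact: (strong_law Hmu HmuN Htau c0 c12 Hn).
Qed.
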